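(* Let $\lambda\in(-\pi/2,\pi/2)$ and let $f$ be a $\lambda$-spirallike function on the unit disk $\mathbb{D}=\{z\in\mathbb{C}:|z|<1\}$. Then for every $r\in(0,1)$, $$L(r,f)\le M(r,f)\left(2\sqrt2\,\pi+4\cos\lambda\cdot\log\frac{1+r}{1-r}\right).$$
   Context: For $\lambda\in(-\pi/2,\pi/2)$ and $w\in\mathbb{C}$, the $\lambda$-spiral segment joining $w$ and $0$ is $[0,w]_\lambda=\{w\exp(te^{i\lambda}):-\infty<t\le 0\}\cup\{0\}$. A domain $\Omega\subset\mathbb{C}$ with $0\in\Omega$ is called $\lambda$-spirallike with respect to the origin if $[0,w]_\lambda\subset\Omega$ whenever $w\in\Omega$. A holomorphic function $f$ on $\mathbb{D}$ is called $\lambda$-spirallike if $f(0)=0$ and $f$ maps $\mathbb{D}$ univalently (injectively) onto a domain that is $\lambda$-spirallike with respect to the origin. For $0<r<1$, $L(r,f)=\int_0^{2\pi}r|f'(re^{i\theta})|\,d\theta$ and $M(r,f)=\max_{|z|=r}|f(z)|$. *)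

(* Defs.v *)
From Stdlib Require Import Reals Lra.
From Coquelicot Require Import Coquelicot.
Open Scope R_scope.

Definition Cexp (z : C) : C :=
  (exp (Re z) * cos (Im z), exp (Re z) * sin (Im z)).

Definition unit_disk (z : C) : Prop := Cmod z < 1.

(* Complex differentiability: the scalar field is [C_AbsRing]. *)
Definition holomorphic_on (D : C -> Prop) (f : C -> C) : Prop :=
  forall z : C, D z -> @ex_derive C_AbsRing C_NormedModule f z.

Definition injective_on (D : C -> Prop) (f : C -> C) : Prop :=
  forall z w : C, D z -> D w -> f z = f w -> z = w.

Definition image (f : C -> C) (D : C -> Prop) (w : C) : Prop :=
  exists z : C, D z /\ f z = w.

(* Coquelicot's [is_connected] is specific to subsets of R. *)
Definition connected (Omega : C -> Prop) : Prop :=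
  forall U V : C -> Prop, open U -> open V ->
    (forall w, Omega w -> U w \/ V w) ->
    (forall w, Omega w -> ~ (U w /\ V w)) ->
    (forall w, Omega w -> U w) \/ (forall w, Omega w -> V w).

Definition is_domain (Omega : C -> Prop) : Prop :=
  (exists w, Omega w) /\ open Omega /\ connected Omega.

Definition spiral_segment (lambda : R) (w u : C) : Prop :=
  (exists t : R, t <= 0 /\ u = (w * Cexp (t * Cexp (Ci * lambda)))%C)
  \/ u = 0.

Definition spirallike_domain (lambda : R) (Omega : C -> Prop) : Prop :=
  is_domain Omega /\ Omega 0 /\
  forall w : C, Omega w -> forall u : C, spiral_segment lambda w u -> Omega u.

Definition spirallike (lambda : R) (f : C -> C) : Prop :=
  holomorphic_on unit_disk f /\ f 0 = 0 /\ injective_on unit_disk f /\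
  spirallike_domain lambda (image f unit_disk).

Definition L (r : R) (f : C -> C) : R :=
  RInt (fun theta : R => r * Cmod (C_derive f (r * Cexp (Ci * theta))%C))
       0 (2 * PI).

(* A supremum by definition; [M_is_max] below shows that it is the maximum
   when [f] is holomorphic on the unit disk. *)
Definition M (r : R) (f : C -> C) : R :=
  real (Lub_Rbar (fun x : R => exists z : C, Cmod z = r /\ x = Cmod (f z))).

Lemma circle_param (r : R) (z : C) : 0 < r -> Cmod z = r ->
  exists theta : R, 0 <= theta <= 2 * PI /\ z = (r * cos theta, r * sin theta).
Proof.
intros Hr Hz.
assert (H2 : (fst z / r) ^ 2 + (snd z / r) ^ 2 = 1).
{ assert (H : fst z ^ 2 + snd z ^ 2 = r ^ 2).
  { rewrite <- Hz. symmetry. apply Cmod2_alt. }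
  replace ((fst z / r) ^ 2 + (snd z / r) ^ 2)
    with ((fst z ^ 2 + snd z ^ 2) / r ^ 2) by (field; lra).
  rewrite H. field. lra. }
set (x := fst z / r) in *. set (y := snd z / r) in *.
assert (Ez : z = (r * x, r * y)).
{ destruct z as [a b]; unfold x, y; simpl; f_equal; field; lra. }
rewrite Ez.
assert (Hx : -1 <= x <= 1) by nra.
assert (Hs : sqrt (1 - Rsqr x) = Rabs y).
{ rewrite <- sqrt_Rsqr_abs. f_equal. unfold Rsqr. nra. }
pose proof (acos_bound x) as Hb.
destruct (Rle_lt_dec 0 y) as [Hy | Hy].
- exists (acos x). split; [lra |].
  rewrite (cos_acos x Hx), (sin_acos x Hx), Hs, Rabs_pos_eq; auto.
- exists (2 * PI - acos x). split; [lra |].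
  replace (2 * PI - acos x) with (- acos x + 2 * INR 1 * PI) by (simpl; ring).
  rewrite cos_period, sin_period, cos_neg, sin_neg.
  rewrite (cos_acos x Hx), (sin_acos x Hx), Hs, Rabs_left by lra.
  f_equal; ring.
Qed.

Lemma M_is_max (r : R) (f : C -> C) :
  0 < r < 1 -> holomorphic_on unit_disk f ->
  (exists z : C, Cmod z = r /\ Cmod (f z) = M r f) /\
  (forall z : C, Cmod z = r -> Cmod (f z) <= M r f).
Proof.
intros Hr Hf.
set (p := fun theta : R => (r * cos theta, r * sin theta) : C).
assert (Hp : forall theta, Cmod (p theta) = r).
{ intros theta. unfold Cmod, p; cbn [fst snd].
  replace ((r * cos theta) ^ 2 + (r * sin theta) ^ 2) with (Rsqr r).
  - apply sqrt_Rsqr; lra.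
  - pose proof (sin2_cos2 theta) as H. unfold Rsqr in *. nra. }
destruct (continuity_ab_maj (fun theta => Cmod (f (p theta))) 0 (2 * PI))
  as [th [Hmax _]].
{ pose proof PI_RGT_0; lra. }
{ intros c _. apply continuity_pt_filterlim.
  change (continuous (fun theta => Cmod (f (p theta))) c).
  apply (continuous_comp (fun theta => f (p theta)) Cmod).
  - apply (continuous_comp p f).
    + apply (continuous_comp_2 (fun t => r * cos t) (fun t => r * sin t)
               (fun a b => (a, b) : C)).
      * apply (continuous_scal_r r cos), continuous_cos.
      * apply (continuous_scal_r r sin), continuous_sin.
      * apply (continuous_ext (fun ab => ab)); [now intros [a b] |].
        apply continuous_id.
    + intros P HP. apply locally_C.
      refine (@ex_derive_continuous C_AbsRing C_NormedModule f (p c) _ P HP).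
      apply Hf. unfold unit_disk. rewrite Hp. lra.
  - apply (@filterlim_norm C_AbsRing C_NormedModule). }
assert (Hub : forall z, Cmod z = r -> Cmod (f z) <= Cmod (f (p th))).
{ intros z Hz. destruct (circle_param r z) as [t [Ht Ez]]; [lra | exact Hz |].
  rewrite Ez. exact (Hmax t Ht). }
assert (E : M r f = Cmod (f (p th))).
{ unfold M. rewrite (is_lub_Rbar_unique _ (Finite (Cmod (f (p th))))).
  - reflexivity.
  - split.
    + intros x [z [Hz ->]]. apply Hub, Hz.
    + intros b Hb. apply Hb. exists (p th). auto. }
rewrite E. split; [exists (p th); auto | exact Hub].
Qed.

(* Main.v *)
(** Write f'(z) z = f(z) h(z).  For t <= 0 the map f^{-1}(e^{t e^{i lambda}} f) sends the
    disk into itself and fixes 0, so by Schwarz's lemma it does not increase moduli;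
    differentiating at t = 0 gives Re(e^{-i lambda} h) >= 0.  Hence
    e^{-i lambda} h = cos lambda P - i sin lambda with P(0) = 1 and Re P >= 0, and
      |h| <= cos lambda Re P + |sin lambda| + cos lambda |Im P|.
    On |z| = r the first two terms integrate to 2 pi (cos lambda + |sin lambda|), at most
    2 sqrt 2 pi.  By Schwarz's integral formula Im P is the convolution of Re P, of mean
    value 1 on the circle of radius rho > r, with an explicit kernel whose L^1 norm gives
    the bound 4 log((rho + r) / (rho - r)) for the integral of |Im P|; then rho tends to 1.

    The complex analysis rests on the mean value property over concentric circles, which
    is Goursat's theorem for rectangles pulled back by z = a + e^w.  Since it needs only
    continuity at the centre, it applies to difference quotients (f z - f a) / (z - a),
    and this yields Cauchy's formula for f', hence the holomorphy of f'. *)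
Require Import Defs.
From Stdlib Require Import Reals Lra Classical ClassicalEpsilon.
From Coquelicot Require Import Coquelicot.
Open Scope R_scope.

(** * Continuity and complex derivatives *)

(** Injectivity does the work of a theory of zeros. As f z - f a vanishes only at z = a, reciprocals
    of such functions are holomorphic where they are wanted, and the mean value property for 1 / F
    bounds |F| below at the centre of a circle. This yields f' <> 0, the continuity of f^{-1}, and
    then the holomorphy of f^{-1}(c f) that Schwarz's lemma requires, without the argument principle
    or the open mapping theorem.

    The auxiliary radius rho > r is there because the kernel blows up when the two circles coincide,
    while P has no boundary values on |z| = 1.

    The constant 4 arises as follows. The kernel Im (zeta / (zeta - z)) is the angular derivative of
    log |zeta - z| and keeps its sign on each half circle, so its L^1 norm is 2 log((rho + r) / (rho
    - r)). Schwarz's formula contributes the factor 1 / pi, and Re P has integral 2 pi. *)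

Lemma norm_C_R (z : C) : @norm R_AbsRing C_R_NormedModule z = Cmod z.
Proof.
  destruct z as [x y]. unfold Cmod. cbn.
  unfold prod_norm. cbn. unfold abs; cbn. f_equal.
  rewrite !Rmult_1_r, <- !Rabs_mult, !Rabs_pos_eq; nra.
Qed.

Lemma ball_C_Cmod (z w : C) (eps : R) : Cmod (w - z) < eps -> ball (z : C_UniformSpace) eps w.
Proof. apply C_NormedModule_mixin_compat1. Qed.

(** Balls of the uniform structure on C are squares; a square of half-side eps fits in the disk of
    radius sqrt 2 * eps, and the cruder factor 2 is enough for neighbourhoods. *)
Lemma Cmod_ball_C (z w : C) (eps : R) :
  0 < eps -> ball (z : C_UniformSpace) eps w -> Cmod (w - z) < 2 * eps.
Proof.
  intros He Hb.
  pose proof (C_NormedModule_mixin_compat2 z w (mkposreal eps He) Hb) as H.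
  cbn in H. assert (sqrt 2 <= 2).
  { replace 2 with (sqrt (2 * 2)) at 2 by (apply sqrt_square; lra).
    apply sqrt_le_1_alt; lra. }
  change (Cmod (w - z) < sqrt 2 * eps) in H. nra.
Qed.

Lemma locally_C_Cmod (z : C) (P : C -> Prop) :
  locally (z : C_UniformSpace) P <->
  exists d : R, 0 < d /\ forall w, Cmod (w - z) < d -> P w.
Proof.
  split.
  - intros [d Hd]. exists d. split; [apply cond_pos|].
    intros w Hw. apply Hd, ball_C_Cmod, Hw.
  - intros [d [Hd H]]. assert (Hd2 : 0 < d / 2) by lra.
    exists (mkposreal _ Hd2). intros w Hw. apply H.
    pose proof (Cmod_ball_C z w (d / 2) Hd2 Hw). lra.
Qed.

Section continuity.
Context {T : UniformSpace}.
Implicit Types (f g : T -> C) (x : T).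

Lemma continuous_C_eps f x :
  continuous f x <-> forall eps, 0 < eps -> locally x (fun y => Cmod (f y - f x) < eps).
Proof.
  split.
  - intros H eps He.
    apply (H (fun w => Cmod (w - f x) < eps)).
    apply locally_C_Cmod. exists eps. auto.
  - intros H P HP. apply locally_C_Cmod in HP. destruct HP as [d [Hd HP]].
    unfold filtermap. generalize (H d Hd). apply filter_imp. auto.
Qed.

Lemma continuous_C_pair (u v : T -> R) x :
  continuous u x -> continuous v x -> continuous (fun y => (u y, v y) : C) x.
Proof.
  intros Hu Hv.
  apply (continuous_comp_2 u v (fun a b => (a, b) : C)); auto.
  apply (continuous_ext (fun ab => ab)); [now intros [a b] |]. apply continuous_id.
Qed.

Lemma continuous_Re f x : continuous f x -> continuous (fun y => Re (f y)) x.
Proof. intros H. apply (continuous_comp f fst); auto. apply continuous_fst. Qed.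

Lemma continuous_Im f x : continuous f x -> continuous (fun y => Im (f y)) x.
Proof. intros H. apply (continuous_comp f snd); auto. apply continuous_snd. Qed.

Lemma continuous_Cplus f g x :
  continuous f x -> continuous g x -> continuous (fun y => f y + g y)%C x.
Proof.
  intros Hf Hg. apply continuous_C_pair; apply (continuous_plus (V := R_NormedModule));
    try apply (continuous_Re _ _ Hf); try apply (continuous_Re _ _ Hg);
    try apply (continuous_Im _ _ Hf); apply (continuous_Im _ _ Hg).
Qed.

Lemma continuous_Copp f x : continuous f x -> continuous (fun y => - f y)%C x.
Proof.
  intros Hf. apply continuous_C_pair; apply (continuous_opp (V := R_NormedModule));
    [apply (continuous_Re _ _ Hf) | apply (continuous_Im _ _ Hf)].
Qed.

Lemma continuous_Cminus f g x :
  continuous f x -> continuous g x -> continuous (fun y => f y - g y)%C x.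
Proof. intros Hf Hg. apply continuous_Cplus; auto. now apply continuous_Copp. Qed.

Lemma continuous_Rmult (u v : T -> R) x :
  continuous u x -> continuous v x -> continuous (fun y => u y * v y) x.
Proof. intros Hu Hv. exact (continuous_mult (K := R_AbsRing) u v x Hu Hv). Qed.

Lemma continuous_Cmult f g x :
  continuous f x -> continuous g x -> continuous (fun y => f y * g y)%C x.
Proof.
  intros Hf Hg.
  pose proof (continuous_Re _ _ Hf). pose proof (continuous_Im _ _ Hf).
  pose proof (continuous_Re _ _ Hg). pose proof (continuous_Im _ _ Hg).
  apply continuous_C_pair.
  - apply (continuous_minus (V := R_NormedModule)); now apply continuous_Rmult.
  - apply (continuous_plus (V := R_NormedModule)); now apply continuous_Rmult.
Qed.

Lemma continuous_Cconj f x : continuous f x -> continuous (fun y => Cconj (f y)) x.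
Proof.
  intros Hf. apply continuous_C_pair.
  - apply (continuous_Re _ _ Hf).
  - apply (continuous_opp (V := R_NormedModule)), (continuous_Im _ _ Hf).
Qed.

Lemma continuous_RtoC (u : T -> R) x : continuous u x -> continuous (fun y => RtoC (u y)) x.
Proof. intros H. apply continuous_C_pair; auto. apply continuous_const. Qed.

Lemma continuous_Cmod f x : continuous f x -> continuous (fun y => Cmod (f y)) x.
Proof.
  intros H. apply (continuous_comp f Cmod); auto.
  apply (@filterlim_norm C_AbsRing C_NormedModule).
Qed.

Lemma continuous_Rinv (u : T -> R) x : continuous u x -> u x <> 0 -> continuous (fun y => / u y) x.
Proof.
  intros H H0. apply (continuous_comp u Rinv); auto.
  now apply continuous_Rinv.
Qed.

(** Reduces the continuity of complex inversion to conjugation and real inversion. *)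
Lemma Cinv_conj_div (z : C) : z <> 0 -> (/ z = / RtoC (Cmod z * Cmod z) * Cconj z)%C.
Proof.
  intros H. rewrite RtoC_mult.
  assert (H2 : (Cmod z * Cmod z = z * Cconj z)%C).
  { rewrite <- Cmod2_conj. cbn. rewrite <- !RtoC_mult. f_equal; ring. }
  rewrite H2. field. split; auto. intros E.
  apply H. apply Cmod_eq_0. rewrite <- Cmod_conj, E. apply Cmod_0.
Qed.

Lemma continuous_Cinv f x : continuous f x -> f x <> 0 -> continuous (fun y => / f y)%C x.
Proof.
  intros H H0.
  assert (HC : continuous (fun y => Cmod (f y)) x) by now apply continuous_Cmod.
  apply Cmod_gt_0 in H0.
  apply continuous_ext_loc with (fun y => / RtoC (Cmod (f y) * Cmod (f y)) * Cconj (f y))%C.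
  - apply filter_imp with (fun y => 0 < Cmod (f y)).
    + intros y Hy. rewrite <- Cinv_conj_div; auto. now apply Cmod_gt_0.
    + exact (HC (fun r => 0 < r) (open_gt 0 _ H0)).
  - apply continuous_Cmult.
    + apply continuous_ext with (fun y => RtoC (/ (Cmod (f y) * Cmod (f y)))).
      (* The extension lemma quantifies over all y, also those with f y = 0, where both inverses
         take the default value 0. *)
      * intros y. destruct (Req_dec (Cmod (f y) * Cmod (f y)) 0) as [E | E].
        -- rewrite E, Rinv_0. unfold Cinv, RtoC. cbn. f_equal; unfold Rdiv; ring.
        -- now rewrite RtoC_inv.
      * apply continuous_RtoC, continuous_Rinv; [now apply continuous_Rmult | nra].
    + now apply continuous_Cconj.
Qed.

Lemma continuous_Cdiv f g x :
  continuous f x -> continuous g x -> g x <> 0 -> continuous (fun y => f y / g y)%C x.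
Proof. intros Hf Hg H. apply continuous_Cmult; auto. now apply continuous_Cinv. Qed.

Lemma continuous_Cexp f x : continuous f x -> continuous (fun y => Cexp (f y)) x.
Proof.
  intros Hf.
  pose proof (continuous_Re _ _ Hf). pose proof (continuous_Im _ _ Hf).
  apply continuous_C_pair; apply continuous_Rmult.
  - apply (continuous_comp (fun y => Re (f y)) exp); auto. apply continuous_exp.
  - apply (continuous_comp (fun y => Im (f y)) cos); auto. apply continuous_cos.
  - apply (continuous_comp (fun y => Re (f y)) exp); auto. apply continuous_exp.
  - apply (continuous_comp (fun y => Im (f y)) sin); auto. apply continuous_sin.
Qed.

End continuity.

(** * Complex differentiability and its calculus rules *)

Notation is_Cderive f z l :=
  (@is_derive C_AbsRing C_NormedModule (f : C -> C) (z : C) (l : C)).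
Notation ex_Cderive f z := (@ex_derive C_AbsRing C_NormedModule (f : C -> C) (z : C)).
Notation is_path_derive g t v :=
  (@is_derive R_AbsRing C_R_NormedModule (g : R -> C) (t : R) (v : C)).

Lemma is_Cderive_eps (f : C -> C) (z l : C) :
  is_Cderive f z l <->
  forall eps, 0 < eps -> exists d, 0 < d /\
    forall w, Cmod (w - z) < d -> Cmod (f w - f z - l * (w - z)) <= eps * Cmod (w - z).
Proof.
  split.
  - intros [_ H] eps He.
    specialize (H z (fun P HP => HP) (mkposreal eps He)).
    apply locally_C, locally_C_Cmod in H. destruct H as [d [Hd H]].
    exists d. split; auto. intros w Hw. specialize (H w Hw).
    rewrite (Cmult_comm l). exact H.
  - intros H. split; [apply is_linear_scal_l|].
    intros x Hx.
    rewrite <- (@is_filter_lim_locally_unique C_AbsRing (AbsRing_NormedModule C_AbsRing) z x Hx).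
    intros eps. apply locally_C, locally_C_Cmod.
    destruct (H eps (cond_pos eps)) as [d [Hd H']].
    exists d. split; auto. intros w Hw. specialize (H' w Hw).
    rewrite (Cmult_comm l) in H'. exact H'.
Qed.

Lemma ex_Cderive_continuous (f : C -> C) (z : C) : ex_Cderive f z -> continuous f z.
Proof.
  intros H P HP. apply locally_C.
  exact (@ex_derive_continuous C_AbsRing C_NormedModule f z H P HP).
Qed.

Lemma is_Cderive_derive (f : C -> C) (z : C) : ex_Cderive f z -> is_Cderive f z (C_derive f z).
Proof. intros H. apply C_derive_correct; auto. Qed.

Lemma is_Cderive_value (f : C -> C) (z l l' : C) : is_Cderive f z l -> l = l' -> is_Cderive f z l'.
Proof. now intros H <-. Qed.

(* [is_linear] is a record depending on the normed module, so the derivatives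
   valued in [C_NormedModule] and in [AbsRing_NormedModule C_AbsRing] are not
   convertible, although both modules have the same norm. *)
Lemma is_Cderive_AbsRing (f : C -> C) (z l : C) :
  @is_derive C_AbsRing (AbsRing_NormedModule C_AbsRing) f z l <-> is_Cderive f z l.
Proof.
  split; intros [_ H]; split; try exact H; apply is_linear_scal_l.
Qed.

Lemma is_Cderive_id (z : C) : is_Cderive (fun w => w) z 1.
Proof. apply is_Cderive_AbsRing. exact (@is_derive_id C_AbsRing z). Qed.

Lemma is_Cderive_const (c z : C) : is_Cderive (fun _ => c) z 0.
Proof. exact (@is_derive_const C_AbsRing C_NormedModule c z). Qed.

Lemma is_Cderive_plus (f g : C -> C) (z a b : C) :
  is_Cderive f z a -> is_Cderive g z b -> is_Cderive (fun w => f w + g w)%C z (a + b)%C.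
Proof. exact (@is_derive_plus C_AbsRing C_NormedModule f g z a b). Qed.

Lemma is_Cderive_minus (f g : C -> C) (z a b : C) :
  is_Cderive f z a -> is_Cderive g z b -> is_Cderive (fun w => f w - g w)%C z (a - b)%C.
Proof. exact (@is_derive_minus C_AbsRing C_NormedModule f g z a b). Qed.

Lemma is_Cderive_mult (f g : C -> C) (z a b : C) :
  is_Cderive f z a -> is_Cderive g z b ->
  is_Cderive (fun w => f w * g w)%C z (a * g z + f z * b)%C.
Proof.
  intros Hf%is_Cderive_AbsRing Hg%is_Cderive_AbsRing. apply is_Cderive_AbsRing.
  exact (@is_derive_mult C_AbsRing f g z a b Hf Hg Cmult_comm).
Qed.

Lemma is_Cderive_comp (f g : C -> C) (z a b : C) :
  is_Cderive f (g z) a -> is_Cderive g z b -> is_Cderive (fun w => f (g w)) z (b * a)%C.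
Proof.
  intros Hf Hg%is_Cderive_AbsRing.
  exact (@is_derive_comp C_AbsRing C_NormedModule f g z a b Hf Hg).
Qed.

Lemma is_Cderive_ext_loc (f g : C -> C) (z l : C) (r : R) :
  0 < r -> (forall w, Cmod (w - z) < r -> f w = g w) -> is_Cderive f z l -> is_Cderive g z l.
Proof.
  intros Hr H. apply (@is_derive_ext_loc C_AbsRing C_NormedModule).
  apply locally_C, locally_C_Cmod. exists r. auto.
Qed.

Lemma Cmod_minus_sym (z w : C) : Cmod (z - w) = Cmod (w - z).
Proof. rewrite <- Cmod_opp. f_equal. ring. Qed.

Lemma Cmod_triangle_minus (z w : C) : Cmod (z - w) <= Cmod z + Cmod w.
Proof. rewrite <- (Cmod_opp w). apply Cmod_triangle. Qed.

Lemma Cmod_triangle_lower (z w : C) : Cmod z - Cmod w <= Cmod (z - w).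
Proof.
  pose proof (Cmod_triangle (z - w) w) as H. replace (z - w + w)%C with z in H by ring. lra.
Qed.

Lemma is_Cderive_Cinv (z : C) : z <> 0 -> is_Cderive Cinv z (- / (z * z))%C.
Proof.
  intros Hz. apply is_Cderive_eps. intros eps He.
  assert (Hm : 0 < Cmod z) by now apply Cmod_gt_0.
  set (m := Cmod z) in *.
  (* The first bound keeps |w| > m / 2; then the error |w - z|^2 / (|w| m^2) is at most eps |w - z|
     as soon as |w - z| <= eps m^3 / 2. *)
  exists (Rmin (m / 2) (eps * (m * m * m) / 2)). split.
  { apply Rmin_glb_lt; [lra|]. assert (0 < eps * (m * m * m)); [|lra].
    apply Rmult_lt_0_compat; auto. apply Rmult_lt_0_compat; auto. nra. }
  intros w Hw.
  assert (Hw1 : Cmod (w - z) < m / 2) by (eapply Rlt_le_trans; [apply Hw | apply Rmin_l]).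
  assert (Hw2 : Cmod (w - z) < eps * (m * m * m) / 2) by (eapply Rlt_le_trans; [apply Hw | apply Rmin_r]).
  assert (Hwm : m / 2 < Cmod w).
  { pose proof (Cmod_triangle_lower z (z - w)) as H. replace (z - (z - w))%C with w in H by ring.
    rewrite (Cmod_minus_sym z w) in H. fold m in H. lra. }
  assert (Hw0 : w <> 0) by (apply Cmod_gt_0; lra).
  replace (/ w - / z - - / (z * z) * (w - z))%C with ((w - z) * (w - z) / (w * (z * z)))%C by (field; auto).
  assert (Hzz : (z * z <> 0)%C) by now apply Cmult_neq_0.
  rewrite Cmod_div by now apply Cmult_neq_0.
  rewrite !Cmod_mult. fold m.
  assert (0 < Cmod w * (m * m)) by (apply Rmult_lt_0_compat; nra).
  apply Rmult_le_reg_r with (Cmod w * (m * m)); auto.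
  unfold Rdiv. rewrite Rmult_assoc, Rinv_l, Rmult_1_r by lra.
  pose proof (Cmod_ge_0 (w - z)).
  assert (eps * (m * m * m) / 2 <= eps * (Cmod w * (m * m))).
  { replace (eps * (m * m * m) / 2) with (eps * (m / 2 * (m * m))) by field.
    apply Rmult_le_compat_l; [lra|]. apply Rmult_le_compat_r; nra. }
  nra.
Qed.

Lemma is_Cderive_div (f g : C -> C) (z a b : C) :
  is_Cderive f z a -> is_Cderive g z b -> g z <> 0 ->
  is_Cderive (fun w => f w / g w)%C z ((a * g z - f z * b) / (g z * g z))%C.
Proof.
  intros Hf Hg H0.
  pose proof (is_Cderive_comp Cinv g z _ _ (is_Cderive_Cinv _ H0) Hg) as Hi.
  pose proof (is_Cderive_mult _ _ _ _ _ Hf Hi) as H.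
  eapply is_Cderive_value; [exact H|]. cbn. field. auto.
Qed.

Lemma Cexp_plus (z w : C) : Cexp (z + w) = (Cexp z * Cexp w)%C.
Proof.
  destruct z as [x y], w as [u v]. unfold Cexp, Cmult. cbn.
  rewrite exp_plus, cos_plus, sin_plus. f_equal; ring.
Qed.

Lemma Cexp_0 : Cexp 0 = 1.
Proof. unfold Cexp. cbn. rewrite exp_0, cos_0, sin_0. unfold RtoC. f_equal; ring. Qed.

Lemma Cmod_Cexp (z : C) : Cmod (Cexp z) = exp (Re z).
Proof.
  destruct z as [x y]. unfold Cexp, Cmod. cbn.
  replace (exp x * cos y * (exp x * cos y * 1) + exp x * sin y * (exp x * sin y * 1))
    with (exp x * exp x).
  - apply sqrt_square. left. apply exp_pos.
  - pose proof (sin2_cos2 y) as H. unfold Rsqr in H.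
    replace (exp x * cos y * (exp x * cos y * 1) + exp x * sin y * (exp x * sin y * 1))
      with (exp x * exp x * (sin y * sin y + cos y * cos y)) by ring.
    rewrite H. ring.
Qed.

Lemma Cexp_neq_0 (z : C) : Cexp z <> 0.
Proof. apply Cmod_gt_0. rewrite Cmod_Cexp. apply exp_pos. Qed.

(** * Paths and complex-valued integrals *)

Lemma is_path_derive_pair (u v : R -> R) (t a b : R) :
  is_derive u t a -> is_derive v t b -> is_path_derive (fun s => (u s, v s)) t (a, b).
Proof.
  intros [_ Hu] [_ Hv]. split.
  { apply (@is_linear_scal_l R_AbsRing C_R_NormedModule). }
  intros x Hx.
  rewrite <- (@is_filter_lim_locally_unique R_AbsRing (AbsRing_NormedModule R_AbsRing) t x Hx).
  specialize (Hu t (fun P HP => HP)). specialize (Hv t (fun P HP => HP)).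
  intros eps. assert (He : 0 < eps / 2) by (pose proof (cond_pos eps); lra).
  generalize (filter_and _ _ (Hu (mkposreal _ He)) (Hv (mkposreal _ He))).
  apply filter_imp. intros y [H1 H2].
  set (A := u y + - u t + - ((y + - t) * a)).
  set (B := v y + - v t + - ((y + - t) * b)).
  change (Rabs A <= eps / 2 * Rabs (y + - t)) in H1.
  change (Rabs B <= eps / 2 * Rabs (y + - t)) in H2.
  rewrite norm_C_R. change (Cmod (A, B) <= eps * Rabs (y + - t)).
  replace ((A, B) : C) with (RtoC A + Ci * RtoC B)%C
    by (unfold Cplus, Cmult, Ci, RtoC; cbn; f_equal; ring).
  eapply Rle_trans; [apply Cmod_triangle|].
  rewrite Cmod_mult, Cmod_Ci, !Cmod_R. lra.
Qed.

Lemma is_path_derive_value (g : R -> C) (t : R) (a b : C) :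
  is_path_derive g t a -> a = b -> is_path_derive g t b.
Proof. now intros H <-. Qed.

Lemma is_path_derive_Re (g : R -> C) (t : R) (v : C) :
  is_path_derive g t v -> is_derive (fun s => Re (g s)) t (Re v).
Proof.
  intros [_ H]. split; [apply is_linear_scal_l|].
  intros x Hx. specialize (H x Hx).
  intros eps. generalize (H eps). apply filter_imp. intros y Hy.
  rewrite norm_C_R in Hy. eapply Rle_trans; [|exact Hy].
  exact (re_le_Cmod (@minus C_R_NormedModule (minus (g y) (g x)) (scal (minus y x) v))).
Qed.

(** This chain rule mixes two scalar fields: [HF] first turns multiplication by l into an R-linear
    differential of f, which is then composed with the differential of the path. *)
Lemma is_Cderive_comp_path (f : C -> C) (g : R -> C) (t : R) (l v : C) :
  is_Cderive f (g t) l -> is_path_derive g t v -> is_path_derive (fun s => f (g s)) t (l * v)%C.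
Proof.
  intros Hf Hg.
  assert (HF : @filterdiff R_AbsRing C_R_NormedModule C_R_NormedModule f (locally (g t)) (fun y => (l * y)%C)).
  { split.
    - split.
      + intros x y. apply Cmult_plus_distr_l.
      + intros k [x1 x2]. destruct l as [l1 l2].
        apply injective_projections; cbn; unfold mult; cbn; ring.
      + exists (Cmod l + 1). split; [pose proof (Cmod_ge_0 l); lra|].
        intros x. rewrite !norm_C_R, Cmod_mult. apply Rmult_le_compat_r; [apply Cmod_ge_0|lra].
    - intros x Hx.
      rewrite <- (@is_filter_lim_locally_unique R_AbsRing C_R_NormedModule (g t) x Hx).
      intros eps. apply (locally_C_Cmod (g t)).
      destruct (proj1 (is_Cderive_eps f (g t) l) Hf eps (cond_pos eps)) as [d [Hd H]].
      exists d. split; auto. intros w Hw. rewrite !norm_C_R. exact (H w Hw). }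
  pose proof (@filterdiff_comp' R_AbsRing (AbsRing_NormedModule R_AbsRing) C_R_NormedModule
    C_R_NormedModule g f t _ _ Hg HF) as H.
  refine (@filterdiff_ext_lin R_AbsRing (AbsRing_NormedModule R_AbsRing) C_R_NormedModule
    (locally t) _ _ _ _ H _).
  intros y. destruct l as [l1 l2], v as [v1 v2].
  apply injective_projections; cbn; unfold mult; cbn; ring.
Qed.

Lemma is_path_derive_affine (z u : C) (t : R) : is_path_derive (fun s => z + s * u)%C t u.
Proof.
  apply is_derive_ext with (fun s => (Re z + s * Re u, Im z + s * Im u) : C).
  - intros s. destruct z, u. unfold Cplus, Cmult. cbn. f_equal; ring.
  - destruct z as [z1 z2], u as [u1 u2]. cbn.
    apply is_path_derive_pair; auto_derive; auto; ring.
Qed.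

Lemma is_path_derive_mult (f g : R -> C) (t : R) (a b : C) :
  is_path_derive f t a -> is_path_derive g t b ->
  is_path_derive (fun s => f s * g s)%C t (a * g t + f t * b)%C.
Proof.
  assert (P : forall (f : R -> C) t a, is_path_derive f t a ->
    is_derive (fun s => Re (f s)) t (Re a) /\ is_derive (fun s => Im (f s)) t (Im a)).
  { clear. intros f t a H. split; [now apply is_path_derive_Re|].
    (* The imaginary part is the real part after multiplication by -i. *)
    pose proof (is_Cderive_comp_path (fun z => - Ci * z)%C f t (- Ci)%C a) as H1.
    apply is_derive_ext with (fun s => Re (- Ci * f s)).
    - intros s. destruct (f s). cbn. ring.
    - replace (Im a) with (Re (- Ci * a)) by (destruct a; cbn; ring).
      apply is_path_derive_Re, H1; auto.
      eapply is_Cderive_value; [apply is_Cderive_mult; [apply is_Cderive_const | apply is_Cderive_id]|].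
      cbn. ring. }
  intros Hf Hg. apply P in Hf. apply P in Hg. destruct Hf as [F1 F2], Hg as [G1 G2].
  apply is_derive_ext with (fun s => (Re (f s) * Re (g s) - Im (f s) * Im (g s),
                                     Re (f s) * Im (g s) + Im (f s) * Re (g s)) : C).
  { intros s. reflexivity. }
  eapply is_path_derive_value.
  - apply is_path_derive_pair.
    + apply (@is_derive_minus R_AbsRing R_NormedModule); apply (@is_derive_mult R_AbsRing);
        eauto; exact Rmult_comm.
    + apply (@is_derive_plus R_AbsRing R_NormedModule); apply (@is_derive_mult R_AbsRing);
        eauto; exact Rmult_comm.
  - unfold mult, plus, minus, opp. cbn. unfold Cplus, Cmult. cbn. unfold Re, Im. f_equal; ring.
Qed.

(* Apply the real mean value theorem to [Re (Cconj c * h)] along the segment,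
   where [c] is the increment of [h]. *)
Lemma Cderive_mean_value_inequality (h h' : C -> C) (z0 z : C) (K : R) :
  (forall w, Cmod (w - z0) <= Cmod (z - z0) -> is_Cderive h w (h' w)) ->
  (forall w, Cmod (w - z0) <= Cmod (z - z0) -> Cmod (h' w) <= K) ->
  Cmod (h z - h z0) <= K * Cmod (z - z0).
Proof.
  intros Hd HK.
  set (c := (h z - h z0)%C).
  set (p := fun t : R => (z0 + t * (z - z0))%C).
  assert (Hp : forall t, 0 <= t <= 1 -> Cmod (p t - z0) <= Cmod (z - z0)).
  { intros t Ht. unfold p. replace (z0 + t * (z - z0) - z0)%C with (t * (z - z0))%C by ring.
    rewrite Cmod_mult, Cmod_R, Rabs_pos_eq by lra.
    pose proof (Cmod_ge_0 (z - z0)). nra. }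
  assert (Hg : forall t, 0 <= t <= 1 ->
    is_derive (fun s => Re (Cconj c * h (p s))) t (Re (Cconj c * (h' (p t) * (z - z0))))).
  { intros t Ht. apply is_path_derive_Re.
    pose proof (is_Cderive_comp_path h p t _ _ (Hd _ (Hp t Ht)) (is_path_derive_affine _ _ _)) as H.
    pose proof (is_path_derive_mult (fun _ => Cconj c) (fun s => h (p s)) t 0 _
      (@is_derive_const R_AbsRing C_R_NormedModule (Cconj c) t) H) as H2.
    eapply is_path_derive_value; [exact H2|]. cbn. ring. }
  destruct (MVT_gen (fun s => Re (Cconj c * h (p s))) 0 1
    (fun t => Re (Cconj c * (h' (p t) * (z - z0))))) as [t [Ht E]].
  - rewrite Rmin_left, Rmax_right by lra. intros x Hx. apply Hg. lra.
  - rewrite Rmin_left, Rmax_right by lra. intros x Hx.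
    apply continuity_pt_filterlim.
    apply (@ex_derive_continuous R_AbsRing R_NormedModule). eexists. apply Hg. lra.
  - rewrite Rmin_left, Rmax_right in Ht by lra.
    assert (Ep1 : p 1 = z) by (unfold p; ring).
    assert (Ep0 : p 0 = z0) by (unfold p; ring).
    rewrite Ep0, Ep1 in E.
    assert (E2 : Cmod c * Cmod c = Re (Cconj c * h z) - Re (Cconj c * h z0)).
    { replace (Re (Cconj c * h z) - Re (Cconj c * h z0)) with (Re (Cconj c * c)).
      - pose proof (Cmod2_alt c) as H. destruct c as [x y]. cbn in *. lra.
      - unfold Rminus. rewrite <- re_opp, <- re_plus. f_equal. unfold c. ring. }
    rewrite E in E2.
    assert (H : Cmod c * Cmod c <= Cmod c * (K * Cmod (z - z0))).
    { rewrite E2, Rminus_0_r, Rmult_1_r. eapply Rle_trans; [apply Rle_abs|].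
      eapply Rle_trans; [apply re_le_Cmod|].
      rewrite !Cmod_mult, Cmod_conj. apply Rmult_le_compat_l; [apply Cmod_ge_0|].
      apply Rmult_le_compat_r; [apply Cmod_ge_0|]. now apply HK, Hp. }
    destruct (Rle_lt_or_eq_dec _ _ (Cmod_ge_0 c)) as [Hc | Hc].
    + apply Rmult_le_reg_l with (Cmod c); auto.
    + change (Cmod c <= K * Cmod (z - z0)). rewrite <- Hc.
      apply Rmult_le_pos; [|apply Cmod_ge_0].
      eapply Rle_trans; [apply Cmod_ge_0|]. apply (HK z). lra.
Qed.

(** * Integrals of complex-valued functions over real intervals *)

Definition CInt (f : R -> C) (a b : R) : C := @RInt C_R_CompleteNormedModule f a b.
Notation is_CInt f a b l := (@is_RInt C_R_NormedModule (f : R -> C) a b (l : C)).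

Definition path_continuous (f : R -> C) (a b : R) : Prop :=
  forall t, a <= t <= b -> continuous f t.

Lemma CInt_unique (f : R -> C) (a b : R) (l : C) : is_CInt f a b l -> CInt f a b = l.
Proof. apply (@is_RInt_unique C_R_CompleteNormedModule). Qed.

Lemma CInt_correct (f : R -> C) (a b : R) :
  a <= b -> path_continuous f a b -> is_CInt f a b (CInt f a b).
Proof.
  intros Hab H. apply (@RInt_correct C_R_CompleteNormedModule).
  apply (@ex_RInt_continuous C_R_CompleteNormedModule).
  rewrite Rmin_left, Rmax_right by lra. exact H.
Qed.

Lemma is_CInt_ReIm (f : R -> C) (a b : R) (l : C) :
  is_CInt f a b l <->
  is_RInt (fun t => Re (f t)) a b (Re l) /\ is_RInt (fun t => Im (f t)) a b (Im l).
Proof.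
  split.
  - intros H. split.
    + exact (@is_RInt_fct_extend_fst R_NormedModule R_NormedModule f a b l H).
    + exact (@is_RInt_fct_extend_snd R_NormedModule R_NormedModule f a b l H).
  - intros [H1 H2]. destruct l as [x y].
    exact (@is_RInt_fct_extend_pair R_NormedModule R_NormedModule f a b x y H1 H2).
Qed.

Lemma is_CInt_scal (f : R -> C) (a b : R) (c l : C) :
  is_CInt f a b l -> is_CInt (fun t => c * f t)%C a b (c * l)%C.
Proof.
  rewrite !is_CInt_ReIm. intros [H1 H2]. destruct c as [x y], l as [u v]. cbn. split.
  - apply is_RInt_ext with (fun t => minus (scal x (Re (f t))) (scal y (Im (f t)))).
    + intros. reflexivity.
    + apply (is_RInt_minus (V := R_NormedModule)); apply (is_RInt_scal (V := R_NormedModule)); assumption.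
  - apply is_RInt_ext with (fun t => plus (scal x (Im (f t))) (scal y (Re (f t)))).
    + intros. reflexivity.
    + apply (is_RInt_plus (V := R_NormedModule)); apply (is_RInt_scal (V := R_NormedModule)); assumption.
Qed.

Lemma is_CInt_conj (f : R -> C) (a b : R) (l : C) :
  is_CInt f a b l -> is_CInt (fun t => Cconj (f t)) a b (Cconj l).
Proof.
  rewrite !is_CInt_ReIm. intros [H1 H2]. split; auto.
  apply (is_RInt_opp (V := R_NormedModule)). exact H2.
Qed.

Section CInt.
Variables (a b : R) (Hab : a <= b).
Implicit Types (f g : R -> C).

Lemma CInt_scal f (c : C) :
  path_continuous f a b -> CInt (fun t => c * f t)%C a b = (c * CInt f a b)%C.
Proof. intros H. now apply CInt_unique, is_CInt_scal, CInt_correct. Qed.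

Lemma CInt_plus f g : path_continuous f a b -> path_continuous g a b ->
  CInt (fun t => f t + g t)%C a b = (CInt f a b + CInt g a b)%C.
Proof.
  intros Hf Hg. apply CInt_unique.
  apply (@is_RInt_plus C_R_NormedModule); now apply CInt_correct.
Qed.

Lemma CInt_minus f g : path_continuous f a b -> path_continuous g a b ->
  CInt (fun t => f t - g t)%C a b = (CInt f a b - CInt g a b)%C.
Proof.
  intros Hf Hg. apply CInt_unique.
  apply (@is_RInt_minus C_R_NormedModule); now apply CInt_correct.
Qed.

Lemma CInt_ext f g :
  (forall t, a <= t <= b -> f t = g t) -> CInt f a b = CInt g a b.
Proof.
  intros H. apply (@RInt_ext C_R_CompleteNormedModule).
  rewrite Rmin_left, Rmax_right by lra. intros x Hx. apply H. lra.
Qed.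

Lemma CInt_conj f : path_continuous f a b ->
  CInt (fun t => Cconj (f t)) a b = Cconj (CInt f a b).
Proof. intros H. now apply CInt_unique, is_CInt_conj, CInt_correct. Qed.

Lemma CInt_const (c : C) : CInt (fun _ => c) a b = ((b - a) * c)%C.
Proof.
  apply CInt_unique.
  replace ((b - a) * c)%C with (@scal R_AbsRing C_R_NormedModule (b - a) c).
  - apply (@is_RInt_const C_R_NormedModule).
  - rewrite scal_R_Cmult. now rewrite RtoC_minus.
Qed.

Lemma Cmod_CInt_le f (K : R) : path_continuous f a b ->
  (forall t, a <= t <= b -> Cmod (f t) <= K) -> Cmod (CInt f a b) <= (b - a) * K.
Proof.
  intros Hf HK. rewrite <- norm_C_R.
  apply (@norm_RInt_le_const C_R_NormedModule f a b _ K Hab).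
  - intros t Ht. rewrite norm_C_R. auto.
  - now apply CInt_correct.
Qed.

Lemma CInt_derive f (F : R -> C) : path_continuous f a b ->
  (forall t, a <= t <= b -> is_path_derive F t (f t)) -> CInt f a b = (F b - F a)%C.
Proof.
  intros Hf HF. apply CInt_unique.
  apply (@is_RInt_derive C_R_CompleteNormedModule);
    rewrite Rmin_left, Rmax_right by lra; auto.
Qed.

Lemma CInt_Chasles f (m : R) : a <= m <= b -> path_continuous f a b ->
  CInt f a b = (CInt f a m + CInt f m b)%C.
Proof.
  intros Hm Hf. symmetry.
  apply (@RInt_Chasles C_R_CompleteNormedModule f a m b); eexists;
    apply CInt_correct; try lra; intros t Ht; apply Hf; lra.
Qed.

Lemma Re_CInt f : path_continuous f a b -> Re (CInt f a b) = RInt (fun t => Re (f t)) a b.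
Proof.
  intros Hf. symmetry. apply is_RInt_unique.
  now apply (proj1 (is_CInt_ReIm f a b _)), CInt_correct.
Qed.

Lemma Im_CInt f : path_continuous f a b -> Im (CInt f a b) = RInt (fun t => Im (f t)) a b.
Proof.
  intros Hf. symmetry. apply is_RInt_unique.
  now apply (proj1 (is_CInt_ReIm f a b _)), CInt_correct.
Qed.

End CInt.

(** * Goursat's theorem *)

Lemma is_derive_R_eps (g : R -> R) (x l eps : R) :
  is_derive g x l -> 0 < eps ->
  exists d, 0 < d /\ forall y, Rabs (y - x) < d -> Rabs (g y - g x - l * (y - x)) <= eps * Rabs (y - x).
Proof.
  intros [_ H] He. specialize (H x (fun P HP => HP) (mkposreal eps He)).
  destruct H as [d Hd]. exists d. split; [apply cond_pos|].
  intros y Hy. specialize (Hd y Hy). rewrite (Rmult_comm l). exact Hd.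
Qed.

(** Splits the error of the linear approximation at 0 into three terms, each controlled by the
    one-variable derivatives of exp, cos and sin at 0. *)
Lemma Cexp_expansion (x y : R) :
  (Cexp (x, y) - 1 - (x, y) =
   RtoC (exp x - 1 - x) * Cexp (0, y) + x * (Cexp (0, y) - 1) + (Cexp (0, y) - 1 - (0, y)))%C.
Proof.
  unfold Cexp; cbn; rewrite exp_0. apply injective_projections; cbn; ring.
Qed.

Lemma is_Cderive_Cexp_0 : is_Cderive Cexp 0 1.
Proof.
  apply is_Cderive_eps. intros eps He.
  (* With m = |(x, y)|, the three terms of [Cexp_expansion] are at most e m, 3 e m and 2 e m. The
     middle one also uses |y| <= e, whence e among the radii below. *)
  set (e := Rmin 1 (eps / 6)).
  assert (He1 : 0 < e) by (apply Rmin_glb_lt; lra).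
  assert (He2 : e <= 1) by apply Rmin_l.
  assert (He3 : e <= eps / 6) by apply Rmin_r.
  destruct (is_derive_R_eps exp 0 1 e) as [d1 [Hd1 H1]]; auto.
  { auto_derive; auto. rewrite exp_0; ring. }
  destruct (is_derive_R_eps cos 0 0 e) as [d2 [Hd2 H2]]; auto.
  { auto_derive; auto. rewrite sin_0; ring. }
  destruct (is_derive_R_eps sin 0 1 e) as [d3 [Hd3 H3]]; auto.
  { auto_derive; auto. rewrite cos_0; ring. }
  exists (Rmin (Rmin d1 d2) (Rmin d3 e)). split.
  { repeat apply Rmin_glb_lt; auto; lra. }
  intros [x y] Hw.
  rewrite Cexp_0. replace ((x, y) - 0)%C with ((x, y) : C) in *
    by (apply injective_projections; cbn; ring).
  rewrite Cmult_1_l.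
  pose proof (Rmin_l (Rmin d1 d2) (Rmin d3 e)). pose proof (Rmin_r (Rmin d1 d2) (Rmin d3 e)).
  pose proof (Rmin_l d1 d2). pose proof (Rmin_r d1 d2).
  pose proof (Rmin_l d3 e). pose proof (Rmin_r d3 e).
  pose proof (Rmax_Cmod (x, y)) as Hm. cbn [fst snd] in Hm.
  pose proof (Rmax_l (Rabs x) (Rabs y)). pose proof (Rmax_r (Rabs x) (Rabs y)).
  set (m := Cmod (x, y)) in *.
  assert (Hx : Rabs x <= m) by lra. assert (Hy : Rabs y <= m) by lra.
  specialize (H1 x). specialize (H2 y). specialize (H3 y).
  rewrite Rminus_0_r in H1, H2, H3.
  specialize (H1 ltac:(lra)). specialize (H2 ltac:(lra)). specialize (H3 ltac:(lra)).
  rewrite exp_0, Rmult_1_l in H1. rewrite cos_0, Rmult_0_l, Rminus_0_r in H2.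
  rewrite sin_0, Rmult_1_l, Rminus_0_r in H3.
  pose proof (Rabs_pos x). pose proof (Rabs_pos y).
  assert (B1 : Cmod (Cexp (0, y) - 1 - (0, y)) <= 2 * e * Rabs y).
  { replace (Cexp (0, y) - 1 - (0, y))%C with (RtoC (cos y - 1) + Ci * RtoC (sin y - y))%C.
    - eapply Rle_trans; [apply Cmod_triangle|]. rewrite Cmod_mult, Cmod_Ci, !Cmod_R. lra.
    - unfold Cexp; cbn; rewrite exp_0. apply injective_projections; cbn; ring. }
  assert (B2 : Cmod (Cexp (0, y) - 1) <= 3 * Rabs y).
  { replace (Cexp (0, y) - 1)%C with ((Cexp (0, y) - 1 - (0, y)) + Ci * RtoC y)%C.
    - eapply Rle_trans; [apply Cmod_triangle|]. rewrite (Cmod_mult Ci), Cmod_Ci, !Cmod_R. nra.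
    - apply injective_projections; cbn; ring. }
  rewrite Cexp_expansion.
  eapply Rle_trans; [apply Cmod_triangle|].
  eapply Rle_trans; [apply Rplus_le_compat_r, Cmod_triangle|].
  rewrite !Cmod_mult, !Cmod_R, Cmod_Cexp. cbn [Re fst]. rewrite exp_0, Rmult_1_r.
  assert (Rabs x * Cmod (Cexp (0, y) - 1) <= m * (3 * e)).
  { apply Rmult_le_compat; try apply Rabs_pos; try apply Cmod_ge_0; auto. lra. }
  assert (m * (6 * e) <= m * eps) by (apply Rmult_le_compat_l; lra).
  nra.
Qed.

Lemma is_Cderive_Cexp (z : C) : is_Cderive Cexp z (Cexp z).
Proof.
  apply (@is_derive_ext C_AbsRing C_NormedModule (fun w => Cexp z * Cexp (w - z))%C).
  { intros w. rewrite <- Cexp_plus. f_equal. ring. }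
  assert (H : is_Cderive (fun w => w - z)%C z 1).
  { eapply is_Cderive_value;
      [apply is_Cderive_minus; [apply is_Cderive_id | apply is_Cderive_const]|]. ring. }
  eapply is_Cderive_value.
  - apply is_Cderive_mult; [apply is_Cderive_const|].
    apply (is_Cderive_comp Cexp (fun w => w - z)%C z 1 1); auto.
    replace (z - z)%C with (RtoC 0) by ring. apply is_Cderive_Cexp_0.
  - cbn. ring.
Qed.

(** The contour integral over the boundary of [a, b] x [c, d], counterclockwise; the factor i is dz
    = i dt on the vertical edges. *)
Definition rect_int (G : C -> C) (a b c d : R) : C :=
  (CInt (fun s => G (s, c)) a b - CInt (fun s => G (s, d)) a b
   + Ci * (CInt (fun t => G (b, t)) c d - CInt (fun t => G (a, t)) c d))%C.

Definition rect_continuous (G : C -> C) (a b c d : R) : Prop :=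
  forall s t, a <= s <= b -> c <= t <= d -> continuous G (s, t).

Lemma rect_continuous_h (G : C -> C) (a b c d t : R) :
  c <= t <= d -> rect_continuous G a b c d -> path_continuous (fun s => G (s, t)) a b.
Proof.
  intros Ht H s Hs. apply (continuous_comp (fun s => (s, t) : C) G); [|now apply H].
  apply continuous_C_pair; [apply continuous_id | apply continuous_const].
Qed.

Lemma rect_continuous_v (G : C -> C) (a b c d s : R) :
  a <= s <= b -> rect_continuous G a b c d -> path_continuous (fun t => G (s, t)) c d.
Proof.
  intros Hs H t Ht. apply (continuous_comp (fun t => (s, t) : C) G); [|now apply H].
  apply continuous_C_pair; [apply continuous_const | apply continuous_id].
Qed.

Lemma rect_continuous_sub (G : C -> C) (a b c d a' b' c' d' : R) :
  a <= a' -> b' <= b -> c <= c' -> d' <= d ->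
  rect_continuous G a b c d -> rect_continuous G a' b' c' d'.
Proof. intros ? ? ? ? H s t Hs Ht. apply H; lra. Qed.

Lemma rect_int_split_h (G : C -> C) (a m b c d : R) :
  a <= m <= b -> c <= d -> rect_continuous G a b c d ->
  rect_int G a b c d = (rect_int G a m c d + rect_int G m b c d)%C.
Proof.
  intros Hm Hcd H. unfold rect_int.
  rewrite (CInt_Chasles a b (fun s => G (s, c)) m)
    by (auto; apply rect_continuous_h with c d; auto; lra).
  rewrite (CInt_Chasles a b (fun s => G (s, d)) m)
    by (auto; apply rect_continuous_h with c d; auto; lra).
  ring.
Qed.

Lemma rect_int_split_v (G : C -> C) (a b c m d : R) :
  a <= b -> c <= m <= d -> rect_continuous G a b c d ->
  rect_int G a b c d = (rect_int G a b c m + rect_int G a b m d)%C.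
Proof.
  intros Hab Hm H. unfold rect_int.
  rewrite (CInt_Chasles c d (fun t => G (a, t)) m)
    by (auto; apply rect_continuous_v with a b; auto; lra).
  rewrite (CInt_Chasles c d (fun t => G (b, t)) m)
    by (auto; apply rect_continuous_v with a b; auto; lra).
  ring.
Qed.

Lemma rect_int_minus (F G : C -> C) (a b c d : R) :
  a <= b -> c <= d -> rect_continuous F a b c d -> rect_continuous G a b c d ->
  rect_int (fun z => F z - G z)%C a b c d = (rect_int F a b c d - rect_int G a b c d)%C.
Proof.
  intros Hab Hcd HF HG. unfold rect_int.
  rewrite !CInt_minus; auto; try ring;
    first [eapply rect_continuous_h; [|eassumption]; lra
          |eapply rect_continuous_v; [|eassumption]; lra].
Qed.

Lemma rect_int_le (G : C -> C) (a b c d K : R) :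
  a <= b -> c <= d -> rect_continuous G a b c d ->
  (forall s t, a <= s <= b -> c <= t <= d -> Cmod (G (s, t)) <= K) ->
  Cmod (rect_int G a b c d) <= 2 * K * ((b - a) + (d - c)).
Proof.
  intros Hab Hcd HG HK. unfold rect_int.
  assert (H1 : Cmod (CInt (fun s => G (s, c)) a b) <= (b - a) * K).
  { apply Cmod_CInt_le; auto. eapply rect_continuous_h; [|eassumption]; lra.
    intros t Ht; apply HK; lra. }
  assert (H2 : Cmod (CInt (fun s => G (s, d)) a b) <= (b - a) * K).
  { apply Cmod_CInt_le; auto. eapply rect_continuous_h; [|eassumption]; lra.
    intros t Ht; apply HK; lra. }
  assert (H3 : Cmod (CInt (fun t => G (a, t)) c d) <= (d - c) * K).
  { apply Cmod_CInt_le; auto. eapply rect_continuous_v; [|eassumption]; lra.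
    intros t Ht; apply HK; lra. }
  assert (H4 : Cmod (CInt (fun t => G (b, t)) c d) <= (d - c) * K).
  { apply Cmod_CInt_le; auto. eapply rect_continuous_v; [|eassumption]; lra.
    intros t Ht; apply HK; lra. }
  eapply Rle_trans; [apply Cmod_triangle|].
  rewrite Cmod_mult, Cmod_Ci.
  pose proof (Cmod_triangle_minus (CInt (fun s => G (s, c)) a b) (CInt (fun s => G (s, d)) a b)).
  pose proof (Cmod_triangle_minus (CInt (fun t => G (b, t)) c d) (CInt (fun t => G (a, t)) c d)).
  lra.
Qed.

(** Each edge contributes a difference of values of Q at two corners, and the four differences
    cancel. *)
Lemma rect_int_primitive (Q q : C -> C) (a b c d : R) :
  a <= b -> c <= d -> (forall z, is_Cderive Q z (q z)) -> (forall z, continuous q z) ->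
  rect_int q a b c d = 0.
Proof.
  intros Hab Hcd HQ Hq. unfold rect_int.
  assert (Hr : rect_continuous q a b c d) by (intros s t _ _; apply Hq).
  assert (Eh : forall t, c <= t <= d -> CInt (fun s => q (s, t)) a b = (Q (b, t) - Q (a, t))%C).
  { intros t Ht. apply (CInt_derive a b Hab (fun s => q (s, t)) (fun s => Q (s, t))).
    - eapply rect_continuous_h; eassumption.
    - intros s _. replace (q (s, t)) with (q (s, t) * (1, 0))%C
        by (destruct (q (s, t)); apply injective_projections; cbn; ring).
      apply is_Cderive_comp_path; auto. apply is_path_derive_pair; auto_derive; auto. }
  assert (Ev : forall s, a <= s <= b -> (Ci * CInt (fun t => q (s, t)) c d)%C = (Q (s, d) - Q (s, c))%C).
  { intros s Hs. assert (Hc : path_continuous (fun t => q (s, t)) c d)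
      by (eapply rect_continuous_v; eassumption).
    rewrite <- CInt_scal by auto.
    apply (CInt_derive c d Hcd (fun t => Ci * q (s, t))%C (fun t => Q (s, t))).
    - intros t Ht. apply continuous_Cmult; [apply continuous_const | now apply Hc].
    - intros t _. rewrite Cmult_comm.
      apply is_Cderive_comp_path; auto. apply is_path_derive_pair; auto_derive; auto. }
  replace (Ci * (CInt (fun t => q (b, t)) c d - CInt (fun t => q (a, t)) c d))%C
    with (Ci * CInt (fun t => q (b, t)) c d - Ci * CInt (fun t => q (a, t)) c d)%C by ring.
  rewrite !Eh, !Ev by lra. ring.
Qed.

Lemma nested_intervals (a b : nat -> R) :
  (forall n, a n <= a (S n)) -> (forall n, b (S n) <= b n) -> (forall n, a n <= b n) ->
  exists p, forall n, a n <= p <= b n.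
Proof.
  intros Ha Hb Hab.
  assert (Hma : forall n k, a n <= a (k + n)%nat).
  { intros n k. induction k; cbn; [lra|]. eapply Rle_trans; [apply IHk | apply Ha]. }
  assert (Hmb : forall n k, b (k + n)%nat <= b n).
  { intros n k. induction k; cbn; [lra|]. eapply Rle_trans; [apply Hb | apply IHk]. }
  assert (H : forall n m, a n <= b m).
  { intros n m. eapply Rle_trans; [apply (Hma n m)|].
    eapply Rle_trans; [apply Hab|]. rewrite Nat.add_comm. apply Hmb. }
  destruct (completeness (fun x => exists n, x = a n)) as [p [Hp1 Hp2]].
  - exists (b 0%nat). intros x [n ->]. apply H.
  - exists (a 0%nat). now exists 0%nat.
  - exists p. intros n. split.
    + apply Hp1. now exists n.
    + apply Hp2. intros x [m ->]. apply H.
Qed.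

Record rect := Rect { rl : R; rr : R; rb : R; rt : R }.

Definition rect_quarter (i j : bool) (q : rect) : rect :=
  let m := (rl q + rr q) / 2 in let n := (rb q + rt q) / 2 in
  Rect (if i then m else rl q) (if i then rr q else m)
       (if j then n else rb q) (if j then rt q else n).

Definition rect_Int (G : C -> C) (q : rect) : C := rect_int G (rl q) (rr q) (rb q) (rt q).

Definition rect_area (q : rect) : R := (rr q - rl q) * (rt q - rb q).

(** Integral and area are both additive over the four quarters, so if no quarter exceeded eps times
    its area, neither would the whole. *)
Lemma rect_quarter_large (G : C -> C) (q : rect) (eps : R) :
  rl q <= rr q -> rb q <= rt q -> rect_continuous G (rl q) (rr q) (rb q) (rt q) ->
  eps * rect_area q < Cmod (rect_Int G q) ->
  exists i j, eps * rect_area (rect_quarter i j q) < Cmod (rect_Int G (rect_quarter i j q)).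
Proof.
  intros Hh Hv HG Hbig. apply NNPP. intros Hn.
  assert (H : forall i j, Cmod (rect_Int G (rect_quarter i j q)) <= eps * rect_area (rect_quarter i j q)).
  { intros i j. apply Rnot_lt_le. intros Hc. apply Hn. now exists i, j. }
  pose proof (H true true) as H1. pose proof (H true false) as H2.
  pose proof (H false true) as H3. pose proof (H false false) as H4.
  assert (E : rect_Int G q = (rect_Int G (rect_quarter true true q) + rect_Int G (rect_quarter true false q)
    + (rect_Int G (rect_quarter false true q) + rect_Int G (rect_quarter false false q)))%C).
  { destruct q as [a b c d]. unfold rect_Int, rect_quarter in *. cbn in *.
    rewrite (rect_int_split_h G a ((a + b) / 2) b) by (auto; lra).
    rewrite (rect_int_split_v G a _ c ((c + d) / 2) d)
      by (first [lra | eapply rect_continuous_sub; [..|exact HG]; lra]).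
    rewrite (rect_int_split_v G _ b c ((c + d) / 2) d)
      by (first [lra | eapply rect_continuous_sub; [..|exact HG]; lra]).
    ring. }
  rewrite E in Hbig.
  pose proof (Cmod_triangle (rect_Int G (rect_quarter true true q) + rect_Int G (rect_quarter true false q))
    (rect_Int G (rect_quarter false true q) + rect_Int G (rect_quarter false false q))).
  pose proof (Cmod_triangle (rect_Int G (rect_quarter true true q)) (rect_Int G (rect_quarter true false q))).
  pose proof (Cmod_triangle (rect_Int G (rect_quarter false true q)) (rect_Int G (rect_quarter false false q))).
  assert (EA : rect_area q = rect_area (rect_quarter true true q) + rect_area (rect_quarter true false q)
    + (rect_area (rect_quarter false true q) + rect_area (rect_quarter false false q))).
  { unfold rect_area, rect_quarter. cbn. field. }
  rewrite EA in Hbig. lra.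
Qed.

Lemma dependent_choice {T : Type} (P : T -> Prop) (S : T -> T -> Prop) (x0 : T) :
  P x0 -> (forall x, P x -> exists y, P y /\ S x y) ->
  exists u : nat -> T, u 0%nat = x0 /\ forall n, P (u n) /\ S (u n) (u (Datatypes.S n)).
Proof.
  intros H0 H.
  pose (next := fun x : {x | P x} =>
    let y := constructive_indefinite_description _ (H (proj1_sig x) (proj2_sig x)) in
    exist P (proj1_sig y) (proj1 (proj2_sig y))).
  pose (v := fun n => Nat.iter n next (exist P x0 H0)).
  exists (fun n => proj1_sig (v n)). split; [reflexivity|].
  intros n. split; [exact (proj2_sig (v n))|].
  change (v (Datatypes.S n)) with (next (v n)). cbn.
  destruct (constructive_indefinite_description _ _) as [y [Hy1 Hy2]]. exact Hy2.
Qed.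

(** A nonzero integral exceeds some eps times the area, and this excess passes to a nested sequence
    of quarters. Near their common point G is too close to an affine function, whose integral
    vanishes, for the excess to persist. *)
Lemma goursat (G : C -> C) (a b c d : R) :
  a <= b -> c <= d ->
  (forall s t, a <= s <= b -> c <= t <= d -> ex_Cderive G (s, t)) ->
  rect_int G a b c d = 0.
Proof.
  intros Hab Hcd HG.
  assert (HGc : rect_continuous G a b c d).
  { intros s t Hs Ht. now apply ex_Cderive_continuous, HG. }
  apply NNPP. intros Hne.
  assert (Hpos : 0 < Cmod (rect_int G a b c d)) by (apply Cmod_gt_0; auto).
  set (D := (b - a) + (d - c)).
  assert (HD : 0 <= D) by (unfold D; lra).
  set (A := (b - a) * (d - c)).
  assert (HA : 0 <= A) by (apply Rmult_le_pos; lra).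
  (* Adding 1 to the area keeps the quotient meaningful for a degenerate rectangle. *)
  set (eps := Cmod (rect_int G a b c d) / (2 * (A + 1))).
  assert (Heps : 0 < eps) by (apply Rdiv_lt_0_compat; lra).
  assert (Hbad : eps * A < Cmod (rect_int G a b c d)).
  { unfold eps. set (M := Cmod (rect_int G a b c d)) in *.
    replace (M / (2 * (A + 1)) * A) with (M * (A / (2 * (A + 1)))) by (field; lra).
    assert (A / (2 * (A + 1)) < 1).
    { apply Rmult_lt_reg_r with (2 * (A + 1)); [lra|].
      unfold Rdiv. rewrite Rmult_assoc, Rinv_l by lra. lra. }
    nra. }
  destruct (dependent_choice
    (fun q => a <= rl q /\ rr q <= b /\ c <= rb q /\ rt q <= d /\ rl q <= rr q /\ rb q <= rt q /\
              eps * rect_area q < Cmod (rect_Int G q))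
    (fun q q' => exists i j, q' = rect_quarter i j q) (Rect a b c d)) as [u [Hu0 Hu]].
  { cbn. repeat split; try lra; auto. }
  { intros q (H1 & H2 & H3 & H4 & H5 & H6 & H7).
    destruct (rect_quarter_large G q eps) as [i [j Hij]]; auto.
    - eapply rect_continuous_sub; [..|exact HGc]; lra.
    - exists (rect_quarter i j q). split; [|eauto].
      repeat split; auto; destruct i, j; cbn; lra. }
  assert (Hstep : forall n, rl (u n) <= rl (u (S n)) /\ rr (u (S n)) <= rr (u n) /\
    rb (u n) <= rb (u (S n)) /\ rt (u (S n)) <= rt (u n) /\
    rr (u (S n)) - rl (u (S n)) = (rr (u n) - rl (u n)) / 2 /\
    rt (u (S n)) - rb (u (S n)) = (rt (u n) - rb (u n)) / 2).
  { intros n. destruct (Hu n) as [(H1 & H2 & H3 & H4 & H5 & H6 & H7) [i [j E]]].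
    rewrite E. destruct i, j; cbn; repeat split; lra. }
  assert (Hsize : forall n, rr (u n) - rl (u n) = (b - a) * (/ 2) ^ n /\
                            rt (u n) - rb (u n) = (d - c) * (/ 2) ^ n).
  { induction n as [|n [IH1 IH2]].
    - rewrite Hu0. cbn. lra.
    - destruct (Hstep n) as (_ & _ & _ & _ & E1 & E2). cbn. rewrite E1, E2, IH1, IH2. lra. }
  destruct (nested_intervals (fun n => rl (u n)) (fun n => rr (u n))) as [p Hp];
    try (intros n; apply Hstep || apply Hu).
  destruct (nested_intervals (fun n => rb (u n)) (fun n => rt (u n))) as [q Hq];
    try (intros n; apply Hstep || apply Hu).
  assert (Hpq : ex_Cderive G (p, q)).
  { specialize (Hp 0%nat). specialize (Hq 0%nat). rewrite Hu0 in Hp, Hq. apply HG; auto. }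
  destruct Hpq as [l Hl].
  (* With h = 2^{-n}, the n-th integral is above eps A h^2 and, up to the affine part, at most 2 eta
     (D h)^2. This [eta] makes 2 eta D^2 < eps A, a contradiction at every scale. *)
  set (eta := eps * A / (2 * (D * D) + 1)).
  (* If A = 0, one pair of edges has length zero and the other pair coincides and cancels, so the
     integral would vanish. *)
  assert (HA0 : 0 < A).
  { destruct (Rle_lt_or_eq_dec _ _ HA) as [H|H]; auto. exfalso.
    assert (Hz : a = b \/ c = d).
    { unfold A in H. symmetry in H. apply Rmult_integral in H. destruct H; [left|right]; lra. }
    apply Hne. unfold rect_int.
    assert (Z : forall f x, CInt f x x = 0)
      by (intros f x; apply (@RInt_point C_R_CompleteNormedModule)).
    destruct Hz as [E | E]; rewrite <- E, !Z; ring. }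
  assert (Hden : 0 < 2 * (D * D) + 1) by nra.
  assert (Heta : 0 < eta) by (apply Rdiv_lt_0_compat; nra).
  assert (Heta2 : 2 * eta * (D * D) < eps * A).
  { replace (eps * A) with (eta * (2 * (D * D) + 1)) by (unfold eta; field; lra). nra. }
  destruct (proj1 (is_Cderive_eps _ _ _) Hl eta Heta) as [del [Hdel Happ]].
  assert (Hn : exists n, D * (/ 2) ^ n < del).
  { destruct (pow_lt_1_zero (/ 2) ltac:(rewrite Rabs_pos_eq; lra) (del / (D + 1))) as [N HN].
    { apply Rdiv_lt_0_compat; lra. }
    exists N. specialize (HN N (Nat.le_refl _)).
    rewrite Rabs_pos_eq in HN by (apply pow_le; lra).
    apply Rle_lt_trans with ((D + 1) * (/ 2) ^ N).
    - apply Rmult_le_compat_r; [apply pow_le; lra | lra].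
    - apply Rlt_le_trans with ((D + 1) * (del / (D + 1))).
      + apply Rmult_lt_compat_l; lra.
      + right. field. lra. }
  destruct Hn as [n Hn].
  destruct (Hu n) as [(H1 & H2 & H3 & H4 & H5 & H6 & H7) _].
  destruct (Hsize n) as [S1 S2]. specialize (Hp n). specialize (Hq n).
  set (h := (/ 2) ^ n) in *.
  assert (Hh : 0 < h) by (apply pow_lt; lra).
  assert (Hclose : forall s t, rl (u n) <= s <= rr (u n) -> rb (u n) <= t <= rt (u n) ->
    Cmod ((s, t) - (p, q)) <= D * h).
  { intros s t Hs Ht.
    replace ((s, t) - (p, q))%C with (RtoC (s - p) + Ci * RtoC (t - q))%C
      by (apply injective_projections; cbn; ring).
    eapply Rle_trans; [apply Cmod_triangle|]. rewrite Cmod_mult, Cmod_Ci, !Cmod_R.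
    assert (Rabs (s - p) <= (b - a) * h) by (apply Rabs_le; lra).
    assert (Rabs (t - q) <= (d - c) * h) by (apply Rabs_le; lra).
    unfold D. lra. }
  set (aff := fun z : C => (G (p, q) + l * (z - (p, q)))%C).
  assert (Haffc : forall z, continuous aff z).
  { intros z. apply continuous_Cplus; [apply continuous_const|].
    apply continuous_Cmult; [apply continuous_const|].
    apply continuous_Cminus; [apply continuous_id | apply continuous_const]. }
  assert (Haff : rect_Int aff (u n) = 0).
  { apply rect_int_primitive with
      (fun z => G (p, q) * z + l / 2 * ((z - (p, q)) * (z - (p, q))))%C; auto.
    intros z. assert (Hs : is_Cderive (fun w => w - (p, q))%C z 1).
    { eapply is_Cderive_value;
        [apply is_Cderive_minus; [apply is_Cderive_id | apply is_Cderive_const]|]. ring. }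
    eapply is_Cderive_value.
    - apply is_Cderive_plus; apply is_Cderive_mult;
        [apply is_Cderive_const | apply is_Cderive_id | apply is_Cderive_const |].
      apply is_Cderive_mult; exact Hs.
    - unfold aff. field. }
  assert (Hsubc : rect_continuous G (rl (u n)) (rr (u n)) (rb (u n)) (rt (u n)))
    by (eapply rect_continuous_sub; [..|exact HGc]; lra).
  assert (Hle : Cmod (rect_Int G (u n)) <= 2 * (eta * (D * h)) * (D * h)).
  { replace (rect_Int G (u n)) with (rect_Int (fun z => G z - aff z)%C (u n)).
    - eapply Rle_trans; [apply (rect_int_le _ _ _ _ _ (eta * (D * h))); auto|].
      + intros s t Hs Ht. apply continuous_Cminus; auto.
      + intros s t Hs Ht. specialize (Hclose s t Hs Ht).
        specialize (Happ (s, t) ltac:(lra)).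
        replace (G (s, t) - aff (s, t))%C with (G (s, t) - G (p, q) - l * ((s, t) - (p, q)))%C
          by (unfold aff; ring).
        eapply Rle_trans; [exact Happ|]. apply Rmult_le_compat_l; lra.
      + right. rewrite S1, S2. unfold D. ring.
    - unfold rect_Int in *. rewrite rect_int_minus; auto.
      + rewrite Haff. ring.
      + intros s t _ _. apply Haffc. }
  unfold rect_area in H7. rewrite S1, S2 in H7.
  replace (eps * ((b - a) * h * ((d - c) * h))) with (eps * A * (h * h)) in H7 by (unfold A; ring).
  replace (2 * (eta * (D * h)) * (D * h)) with (2 * eta * (D * D) * (h * h)) in Hle by ring.
  assert (0 < h * h) by nra. nra.
Qed.

(** * Mean values over circles *)

Definition circle (a : C) (rho phi : R) : C := (a + rho * Cexp (Ci * phi))%C.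

Lemma Cexp_Ci (phi : R) : Cexp (Ci * phi) = (cos phi, sin phi).
Proof.
  unfold Cexp. cbn.
  replace (0 * phi - 1 * 0) with 0 by ring. replace (0 * 0 + 1 * phi) with phi by ring.
  rewrite exp_0. f_equal; ring.
Qed.

Lemma Cmod_Cexp_Ci (phi : R) : Cmod (Cexp (Ci * phi)) = 1.
Proof. rewrite Cmod_Cexp. cbn. rewrite <- exp_0. f_equal. ring. Qed.

Lemma Cmod_circle (a : C) (rho phi : R) : 0 <= rho -> Cmod (circle a rho phi - a) = rho.
Proof.
  intros H. unfold circle. replace (a + rho * Cexp (Ci * phi) - a)%C with (rho * Cexp (Ci * phi))%C by ring.
  rewrite Cmod_mult, Cmod_Cexp_Ci, Cmod_R, Rabs_pos_eq; lra.
Qed.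

Lemma circle_continuous (a : C) (rho phi : R) : continuous (circle a rho) phi.
Proof.
  apply continuous_Cplus; [apply continuous_const|].
  apply continuous_Cmult; [apply continuous_const|].
  apply continuous_Cexp, continuous_Cmult; [apply continuous_const|].
  apply continuous_RtoC, continuous_id.
Qed.

Lemma circle_path_continuous (F : C -> C) (a : C) (rho x y : R) :
  0 <= rho -> (forall z, Cmod (z - a) = rho -> continuous F z) ->
  path_continuous (fun phi => F (circle a rho phi)) x y.
Proof.
  intros Hr H t _. apply (continuous_comp (circle a rho) F); [apply circle_continuous|].
  now apply H, Cmod_circle.
Qed.

Lemma Cexp_polar (rho phi : R) : 0 < rho -> Cexp (ln rho, phi) = (rho * Cexp (Ci * phi))%C.
Proof.
  intros H. rewrite Cexp_Ci. unfold Cexp. cbn. rewrite exp_ln by auto.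
  apply injective_projections; cbn; ring.
Qed.

Lemma two_PI_pos : 0 < 2 * PI.
Proof. pose proof PI_RGT_0. lra. Qed.

Lemma exp_le_compat (x y : R) : x <= y -> exp x <= exp y.
Proof. intros [H | ->]; [left; now apply exp_increasing | apply Rle_refl]. Qed.

(* The change of variables z = a + e^w maps a rectangle of height 2 pi onto an
   annulus; the two horizontal edges have the same image and cancel out. *)
Lemma circle_integral_annulus (F : C -> C) (a : C) (rho1 rho2 : R) :
  0 < rho1 <= rho2 ->
  (forall z, rho1 <= Cmod (z - a) <= rho2 -> ex_Cderive F z) ->
  CInt (fun phi => F (circle a rho1 phi)) 0 (2 * PI) =
  CInt (fun phi => F (circle a rho2 phi)) 0 (2 * PI).
Proof.
  intros [H1 H2] HF. pose proof two_PI_pos as Hpi.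
  assert (Hln : ln rho1 <= ln rho2) by (apply ln_le; auto).
  pose (G := fun w : C => F (a + Cexp w)%C).
  pose proof (goursat G (ln rho1) (ln rho2) 0 (2 * PI) Hln ltac:(lra)) as HG.
  assert (E : forall rho, 0 < rho ->
    CInt (fun t => G (ln rho, t)) 0 (2 * PI) = CInt (fun phi => F (circle a rho phi)) 0 (2 * PI)).
  { intros rho Hr. apply CInt_ext; [lra|]. intros t _. unfold G. now rewrite Cexp_polar. }
  unfold rect_int in HG. rewrite !E in HG by lra.
  rewrite (CInt_ext (ln rho1) (ln rho2) Hln (fun s => G (s, 2 * PI)) (fun s => G (s, 0))) in HG.
  - match type of HG with _ -> (?X - ?X + Ci * (?U - ?V))%C = _ =>
      assert (H : (Ci * (U - V))%C = 0) end.
    { rewrite <- HG; [ring|]. intros s t Hs Ht.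
      assert (ex_Cderive F (a + Cexp (s, t))%C) as [l Hl].
      { apply HF. replace (a + Cexp (s, t) - a)%C with (Cexp (s, t)) by ring.
        rewrite Cmod_Cexp. cbn.
        rewrite <- (exp_ln rho1), <- (exp_ln rho2) by lra.
        split; apply exp_le_compat; lra. }
      eexists. apply (is_Cderive_comp F (fun w => a + Cexp w)%C); [exact Hl|].
      apply is_Cderive_plus; [apply is_Cderive_const | apply is_Cderive_Cexp]. }
    match type of H with (Ci * (?U - ?V))%C = _ =>
      assert (H' : (U - V)%C = (- Ci * (Ci * (U - V)))%C) end.
    { apply injective_projections; cbn; ring. }
    rewrite H in H'. symmetry. apply Ceq_minus. rewrite H'. ring.
  - intros s _. unfold G. f_equal. f_equal.
    unfold Cexp. cbn. now rewrite sin_2PI, cos_2PI, sin_0, cos_0.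
Qed.

(** By [circle_integral_annulus] the circle may be shrunk without changing the integral, and
    continuity at a brings the integral over a small circle within eps of 2 pi F(a). *)
Lemma circle_mean_value (F : C -> C) (a : C) (rho rho0 : R) :
  0 < rho < rho0 -> continuous F a ->
  (forall z, 0 < Cmod (z - a) < rho0 -> ex_Cderive F z) ->
  CInt (fun phi => F (circle a rho phi)) 0 (2 * PI) = (2 * PI * F a)%C.
Proof.
  intros Hr Ha HF. pose proof two_PI_pos as Hpi.
  apply Ceq_minus, Cmod_eq_0, Rle_antisym; [|apply Cmod_ge_0].
  apply le_epsilon. intros eps He. rewrite Rplus_0_l.
  assert (He' : 0 < eps / (2 * PI)) by (apply Rdiv_lt_0_compat; lra).
  destruct (proj1 (locally_C_Cmod _ _) (proj1 (continuous_C_eps F a) Ha _ He')) as [d [Hd H]].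
  set (rho1 := Rmin rho (d / 2)).
  assert (0 < rho1) by (apply Rmin_glb_lt; lra).
  assert (rho1 <= rho) by apply Rmin_l.
  assert (rho1 < d) by (pose proof (Rmin_r rho (d / 2)); unfold rho1; lra).
  rewrite <- (circle_integral_annulus F a rho1 rho).
  - replace (2 * PI * F a)%C with (CInt (fun _ => F a) 0 (2 * PI))
      by (rewrite CInt_const by lra; rewrite RtoC_mult; ring).
    rewrite <- CInt_minus; try lra.
    + replace eps with ((2 * PI - 0) * (eps / (2 * PI))) by (field; lra).
      apply Cmod_CInt_le; [lra| |].
      * intros t Ht. apply continuous_Cminus; [|apply continuous_const].
        refine (circle_path_continuous F a rho1 0 (2 * PI) _ _ t Ht); [lra|].
        intros z Hz. apply ex_Cderive_continuous, HF. lra.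
      * intros t Ht. left. apply H. rewrite Cmod_circle; lra.
    + apply circle_path_continuous; [lra|].
      intros z Hz. apply ex_Cderive_continuous, HF. lra.
    + intros t _. apply continuous_const.
  - lra.
  - intros z Hz. apply HF. lra.
Qed.

Lemma circle_mean_le (F : C -> C) (a : C) (rho rho0 K : R) :
  0 < rho < rho0 -> continuous F a ->
  (forall z, 0 < Cmod (z - a) < rho0 -> ex_Cderive F z) ->
  (forall z, Cmod (z - a) = rho -> Cmod (F z) <= K) -> Cmod (F a) <= K.
Proof.
  intros Hr Ha HF HK. pose proof two_PI_pos as Hpi.
  pose proof (circle_mean_value F a rho rho0 Hr Ha HF) as E.
  apply (f_equal Cmod) in E.
  assert (H : Cmod (CInt (fun phi => F (circle a rho phi)) 0 (2 * PI)) <= (2 * PI - 0) * K).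
  { apply Cmod_CInt_le; [lra| |].
    - apply circle_path_continuous; [lra|].
      intros z Hz. apply ex_Cderive_continuous, HF. lra.
    - intros t _. apply HK, Cmod_circle; lra. }
  rewrite E, <- RtoC_mult, Cmod_mult, Cmod_R, Rabs_pos_eq in H by lra.
  apply Rmult_le_reg_l with (2 * PI); lra.
Qed.

(** Filling the removable singularity with f'(a) makes the quotient continuous at a, so that
    [circle_mean_value] applies to it around a. *)
Definition slope (f : C -> C) (a z : C) : C :=
  if Ceq_dec z a then C_derive f a else ((f z - f a) / (z - a))%C.

Lemma slope_diag (f : C -> C) (a : C) : slope f a a = C_derive f a.
Proof. unfold slope. destruct (Ceq_dec a a); congruence. Qed.

Lemma slope_off_diag (f : C -> C) (a z : C) : z <> a -> slope f a z = ((f z - f a) / (z - a))%C.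
Proof. intros H. unfold slope. destruct (Ceq_dec z a); congruence. Qed.

Lemma slope_mult (f : C -> C) (a z : C) : (slope f a z * (z - a))%C = (f z - f a)%C.
Proof.
  destruct (Ceq_dec z a) as [->|H]; [ring|].
  rewrite slope_off_diag by auto. field. now apply Cminus_eq_contra.
Qed.

Lemma slope_continuous (f : C -> C) (a : C) : ex_Cderive f a -> continuous (slope f a) a.
Proof.
  intros Hfa. apply continuous_C_eps. intros eps He. apply locally_C_Cmod.
  destruct (proj1 (is_Cderive_eps _ _ _) (is_Cderive_derive f a Hfa) (eps / 2)) as [d [Hd H]]; [lra|].
  exists d. split; auto. intros w Hw. rewrite slope_diag.
  destruct (Ceq_dec w a) as [->|Hwa].
  - rewrite slope_diag. replace (C_derive f a - C_derive f a)%C with (RtoC 0) by ring.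
    rewrite Cmod_0. lra.
  - rewrite slope_off_diag by auto. specialize (H w Hw).
    assert (Hwa' : (w - a <> 0)%C) by now apply Cminus_eq_contra.
    replace ((f w - f a) / (w - a) - C_derive f a)%C
      with ((f w - f a - C_derive f a * (w - a)) / (w - a))%C by (field; auto).
    rewrite Cmod_div by auto. apply Cmod_gt_0 in Hwa'.
    apply Rle_lt_trans with (eps / 2); [|lra].
    apply Rmult_le_reg_r with (Cmod (w - a)); auto.
    unfold Rdiv at 1. rewrite Rmult_assoc, Rinv_l, Rmult_1_r; lra.
Qed.

Lemma slope_ex_Cderive_off_diag (f : C -> C) (a z : C) :
  z <> a -> ex_Cderive f z -> ex_Cderive (slope f a) z.
Proof.
  intros Hz [l Hl]. assert (Hza : (z - a <> 0)%C) by now apply Cminus_eq_contra.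
  eexists. apply (is_Cderive_ext_loc (fun z => (f z - f a) / (z - a))%C _ z _ (Cmod (z - a))).
  - now apply Cmod_gt_0.
  - intros w Hw. rewrite slope_off_diag; auto. intros ->. rewrite Cmod_minus_sym in Hw. lra.
  - apply is_Cderive_div; auto.
    + apply is_Cderive_minus; [exact Hl | apply is_Cderive_const].
    + apply is_Cderive_minus; [apply is_Cderive_id | apply is_Cderive_const].
Qed.

Lemma Cmod_pos_neq (z a : C) : 0 < Cmod (z - a) -> z <> a.
Proof.
  intros H ->. replace (a - a)%C with (RtoC 0) in H by ring. rewrite Cmod_0 in H. lra.
Qed.

(* The mean value property for the difference quotient (f z - f a) / (z - a). *)
Lemma Cderive_circle_integral (f : C -> C) (a : C) (rho rho0 : R) :
  0 < rho < rho0 -> (forall z, Cmod (z - a) < rho0 -> ex_Cderive f z) ->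
  CInt (fun phi => f (circle a rho phi) * Cexp (Ci * (- phi)%R))%C 0 (2 * PI) =
  (2 * PI * rho * C_derive f a)%C.
Proof.
  intros Hr Hf. pose proof two_PI_pos as Hpi.
  assert (Hfa : ex_Cderive f a).
  { apply Hf. replace (a - a)%C with (RtoC 0) by ring. rewrite Cmod_0. lra. }
  assert (HF : forall z, 0 < Cmod (z - a) < rho0 -> ex_Cderive (slope f a) z).
  { intros z Hz. apply slope_ex_Cderive_off_diag; [now apply Cmod_pos_neq|]. apply Hf. lra. }
  pose proof (circle_mean_value (slope f a) a rho rho0 Hr (slope_continuous f a Hfa) HF) as E.
  rewrite slope_diag in E.
  assert (Hexp : forall phi, (Cexp (Ci * (- phi)%R) * Cexp (Ci * phi))%C = 1).
  { intros phi. rewrite <- Cexp_plus, <- Cexp_0. f_equal. rewrite RtoC_opp. ring. }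
  assert (Hrho : RtoC rho <> 0) by (intros Z; apply RtoC_inj in Z; lra).
  assert (Hpc : path_continuous (fun phi => Cexp (Ci * (- phi)%R)) 0 (2 * PI)).
  { intros t _. apply continuous_Cexp, continuous_Cmult; [apply continuous_const|].
    apply continuous_RtoC, (continuous_opp (V := R_NormedModule)), continuous_id. }
  assert (Hpf : path_continuous (fun phi => f (circle a rho phi)) 0 (2 * PI)).
  { apply circle_path_continuous; [lra|]. intros z Hz. apply ex_Cderive_continuous, Hf. lra. }
  rewrite (CInt_ext 0 (2 * PI) ltac:(lra) _
    (fun phi => / rho * (f (circle a rho phi) * Cexp (Ci * (- phi)%R) - f a * Cexp (Ci * (- phi)%R)))%C) in E.
  - rewrite CInt_scal, CInt_minus, CInt_scal in E; try lra; auto.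
    + assert (Z : CInt (fun phi => Cexp (Ci * (- phi)%R)) 0 (2 * PI) = 0).
      { rewrite (CInt_derive 0 (2 * PI) ltac:(lra) _ (fun t => Ci * Cexp (Ci * (- t)%R))%C); auto.
        - rewrite !Cexp_Ci. replace (- (2 * PI)) with (0 - 2 * PI) by ring.
          rewrite cos_minus, sin_minus, cos_2PI, sin_2PI, Ropp_0, cos_0, sin_0.
          apply injective_projections; cbn; ring.
        - intros t _. apply is_derive_ext with (fun t => (sin t, cos t) : C).
          + intros s. rewrite Cexp_Ci, cos_neg, sin_neg. apply injective_projections; cbn; ring.
          + rewrite Cexp_Ci, cos_neg, sin_neg. apply is_path_derive_pair; auto_derive; auto; ring. }
      rewrite Z in E.
      match type of E with (_ * (?X - _))%C = _ =>
        replace X with (rho * (/ rho * (X - f a * 0)))%C by (field; auto) end.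
      rewrite E. ring.
    + intros t Ht. apply continuous_Cmult; auto.
    + intros t Ht. apply continuous_Cmult; auto. apply continuous_const.
    + intros t Ht. apply continuous_Cminus; apply continuous_Cmult; auto. apply continuous_const.
  - intros t _. rewrite slope_off_diag by (apply Cmod_pos_neq; rewrite Cmod_circle; lra).
    replace (circle a rho t - a)%C with (rho * Cexp (Ci * t))%C by (unfold circle; ring).
    pose proof (Cexp_neq_0 (Ci * t)) as Hn.
    replace (Cexp (Ci * (- t)%R)) with (/ Cexp (Ci * t))%C.
    + field. auto.
    + transitivity (/ Cexp (Ci * t) * (Cexp (Ci * (- t)%R) * Cexp (Ci * t)))%C;
        [rewrite Hexp; ring | field; auto].
Qed.

(** * Holomorphy of derivatives and difference quotients *)

Definition jointly_continuous {T : UniformSpace} (K : T -> R -> C) (z : T) (phi : R) : Prop :=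
  continuous (fun p : T * R => K (fst p) (snd p)) (z, phi).

(** Compactness of [a, b]: each t has its own radius for eps / 2, and a single d serves all of them.
    Both K z phi and K z0 phi are then compared with K z0 t at a tagged point t near phi. *)
Lemma jointly_continuous_uniform {T : UniformSpace} (K : T -> R -> C) (a b eps : R) (z0 : T) :
  0 < eps -> (forall phi, a <= phi <= b -> jointly_continuous K z0 phi) ->
  locally z0 (fun z => forall phi, a <= phi <= b -> Cmod (K z phi - K z0 phi) < eps).
Proof.
  intros He HK.
  assert (H : forall phi, exists d : posreal, a <= phi <= b ->
    forall z psi, ball z0 d z -> Rabs (psi - phi) < d -> Cmod (K z psi - K z0 phi) < eps / 2).
  { intros phi. destruct (classic (a <= phi <= b)) as [Hp|Hp].
    - destruct (proj1 (continuous_C_eps _ _) (HK phi Hp) (eps / 2)) as [d Hd]; [lra|].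
      exists d. intros _ z psi Hz Hpsi. apply (Hd (z, psi)). now split.
    (* The gauge must be total; outside [a, b] its value is arbitrary. *)
    - exists (mkposreal 1 Rlt_0_1). intros Hp'. contradiction. }
  pose (delta := fun phi => proj1_sig (constructive_indefinite_description _ (H phi))).
  assert (Hdelta : forall phi, a <= phi <= b -> forall z psi, ball z0 (delta phi) z ->
    Rabs (psi - phi) < delta phi -> Cmod (K z psi - K z0 phi) < eps / 2).
  { intros phi. exact (proj2_sig (constructive_indefinite_description _ (H phi))). }
  destruct (compactness_value_1d a b delta) as [d Hd].
  (* [compactness_value_1d] provides the tagged point only under a double negation. *)
  exists d. intros z Hz phi Hphi. apply NNPP. intros Hn.
  apply (Hd phi Hphi). intros [t [Ht [H1 H2]]]. apply Hn.
  pose proof (Hdelta t Ht z phi (ball_le _ _ _ H2 _ Hz) H1) as B1.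
  pose proof (Hdelta t Ht z0 phi (ball_center _ _) H1) as B2.
  replace (K z phi - K z0 phi)%C with ((K z phi - K z0 t) - (K z0 phi - K z0 t))%C by ring.
  eapply Rle_lt_trans; [apply Cmod_triangle_minus|]. lra.
Qed.

Lemma jointly_continuous_path {T : UniformSpace} (K : T -> R -> C) (a b : R) (z0 : T) :
  (forall phi, a <= phi <= b -> jointly_continuous K z0 phi) -> path_continuous (K z0) a b.
Proof.
  intros H t Ht.
  apply (continuous_comp_2 (fun _ : R => z0) (fun t : R => t) K); [| |now apply H].
  - apply continuous_const.
  - apply continuous_id.
Qed.

Lemma CInt_param_continuous {T : UniformSpace} (K : T -> R -> C) (a b : R) (z0 : T) :
  a <= b -> (forall phi, a <= phi <= b -> jointly_continuous K z0 phi) ->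
  locally z0 (fun z => path_continuous (K z) a b) ->
  continuous (fun z => CInt (K z) a b) z0.
Proof.
  intros Hab HK Hc. apply continuous_C_eps. intros eps He.
  assert (He' : 0 < eps / (b - a + 1)) by (apply Rdiv_lt_0_compat; lra).
  generalize (filter_and _ _ Hc (jointly_continuous_uniform K a b _ z0 He' HK)).
  apply filter_imp. intros z [H1 H2].
  rewrite <- CInt_minus; auto; [|now apply jointly_continuous_path].
  apply Rle_lt_trans with ((b - a) * (eps / (b - a + 1))).
  - apply Cmod_CInt_le; auto.
    + intros t Ht. apply continuous_Cminus; [now apply H1|].
      now apply (jointly_continuous_path K a b z0 HK).
    + intros t Ht. left. auto.
  - apply Rmult_lt_reg_r with (b - a + 1); [lra|].
    replace ((b - a) * (eps / (b - a + 1)) * (b - a + 1)) with ((b - a) * eps) by (field; lra). nra.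
Qed.

(** For fixed t, the mean value inequality applied to K z t - K' z0 t * z bounds the linearisation
    error by the oscillation of K' near z0, which is small uniformly in t. *)
Lemma CInt_param_derive (K K' : C -> R -> C) (a b r : R) (z0 : C) :
  a <= b -> 0 < r ->
  (forall z phi, Cmod (z - z0) < r -> a <= phi <= b -> is_Cderive (fun w => K w phi) z (K' z phi)) ->
  (forall z, Cmod (z - z0) < r -> path_continuous (K z) a b) ->
  (forall phi, a <= phi <= b -> jointly_continuous (K' : C_UniformSpace -> R -> C) z0 phi) ->
  is_Cderive (fun z => CInt (K z) a b) z0 (CInt (K' z0) a b).
Proof.
  intros Hab Hr HK Hc HK'. apply is_Cderive_eps. intros eps He.
  assert (He' : 0 < eps / (b - a + 1)) by (apply Rdiv_lt_0_compat; lra).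
  pose proof (jointly_continuous_uniform K' a b _ z0 He' HK') as Hu.
  pose proof (jointly_continuous_path K' a b z0 HK') as HK'p.
  apply locally_C_Cmod in Hu. destruct Hu as [d [Hd Hu]].
  exists (Rmin d r). split; [now apply Rmin_glb_lt|].
  intros w Hw. pose proof (Rmin_l d r). pose proof (Rmin_r d r).
  assert (Hz0 : path_continuous (K z0) a b).
  { apply Hc. replace (z0 - z0)%C with (RtoC 0) by ring. now rewrite Cmod_0. }
  assert (Hw' : path_continuous (K w) a b) by (apply Hc; lra).
  rewrite (Cmult_comm (CInt _ _ _)), <- CInt_scal, <- !CInt_minus; auto.
  2: { intros t Ht. apply continuous_Cminus; auto. }
  2: { intros t Ht. apply continuous_Cmult; auto. apply continuous_const. }
  pose proof (Cmod_ge_0 (w - z0)).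
  apply Rle_trans with ((b - a) * (eps / (b - a + 1) * Cmod (w - z0))).
  - apply Cmod_CInt_le; auto.
    + intros t Ht. apply continuous_Cminus; [apply continuous_Cminus; auto|].
      apply continuous_Cmult; auto. apply continuous_const.
    + intros t Ht.
      replace (K w t - K z0 t - (w - z0) * K' z0 t)%C
        with ((K w t - K' z0 t * w) - (K z0 t - K' z0 t * z0))%C by ring.
      apply (Cderive_mean_value_inequality (fun z => K z t - K' z0 t * z)%C
        (fun z => K' z t - K' z0 t)%C).
      * intros z Hz. apply is_Cderive_minus; [apply HK; auto; lra|].
        eapply is_Cderive_value;
          [apply is_Cderive_mult; [apply is_Cderive_const | apply is_Cderive_id]|]. cbn. ring.
      * intros z Hz. left. apply Hu; auto. lra.
  - rewrite <- Rmult_assoc. apply Rmult_le_compat_r; auto.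
    apply Rmult_le_reg_r with (b - a + 1); [lra|].
    replace ((b - a) * (eps / (b - a + 1)) * (b - a + 1)) with ((b - a) * eps) by (field; lra). nra.
Qed.

Lemma circle_jointly_continuous (F : C -> C) (rho phi : R) (z0 : C) :
  continuous F (circle z0 rho phi) ->
  jointly_continuous (fun (z : C_UniformSpace) t => (F (circle z rho t) * Cexp (Ci * (- t)%R))%C) z0 phi.
Proof.
  intros HF. apply continuous_Cmult.
  - apply (continuous_comp (fun p : C_UniformSpace * R => circle (fst p) rho (snd p)) F); auto.
    apply continuous_Cplus; [apply continuous_fst|].
    apply continuous_Cmult; [apply continuous_const|].
    apply continuous_Cexp, continuous_Cmult; [apply continuous_const|].
    apply continuous_RtoC, continuous_snd.
  - apply continuous_Cexp, continuous_Cmult; [apply continuous_const|].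
    apply continuous_RtoC, (continuous_opp (V := R_NormedModule)), continuous_snd.
Qed.

Lemma Cmod_circle_le (z a : C) (rho phi : R) :
  0 <= rho -> Cmod (circle z rho phi - a) <= Cmod (z - a) + rho.
Proof.
  intros H. replace (circle z rho phi - a)%C with ((z - a) + (circle z rho phi - z))%C by ring.
  eapply Rle_trans; [apply Cmod_triangle|]. rewrite Cmod_circle; lra.
Qed.

Section derivative.
Variables (f : C -> C) (a : C) (r : R).
Hypotheses (Hr : 0 < r) (Hf : forall z, Cmod (z - a) < r -> ex_Cderive f z).

Let kernel (g : C -> C) (z : C) (t : R) : C := (g (circle z (r / 2) t) * Cexp (Ci * (- t)%R))%C.

(** The radius r / 2 is the same for all z near a, so f' becomes an integral with parameter z; for
    |z - a| < r / 4 the circles stay within 3 r / 4 of a. *)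
Lemma C_derive_circle (z : C) :
  Cmod (z - a) < r / 4 ->
  C_derive f z = (/ RtoC (2 * PI * (r / 2)) * CInt (kernel f z) 0 (2 * PI))%C.
Proof.
  intros Hz. unfold kernel.
  rewrite (Cderive_circle_integral f z (r / 2) (r * (3 / 4))).
  - rewrite <- !RtoC_mult. field. intros E. apply RtoC_inj in E.
    pose proof two_PI_pos. nra.
  - lra.
  - intros w Hw. apply Hf. replace (w - a)%C with ((w - z) + (z - a))%C by ring.
    eapply Rle_lt_trans; [apply Cmod_triangle|]. lra.
Qed.

Lemma kernel_path_continuous (z : C) :
  Cmod (z - a) < r / 4 -> path_continuous (kernel f z) 0 (2 * PI).
Proof.
  intros Hz. apply (@jointly_continuous_path C_UniformSpace (kernel f)).
  intros phi _. apply circle_jointly_continuous, ex_Cderive_continuous, Hf.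
  pose proof (Cmod_circle_le z a (r / 2) phi ltac:(lra)). lra.
Qed.

(** Differentiating [C_derive_circle] under the integral sign puts f' into the integrand, so the
    continuity of f' has to come first. *)
Lemma C_derive_continuous : continuous (C_derive f) a.
Proof.
  pose proof two_PI_pos.
  assert (Ha : Cmod (a - a) = 0) by (replace (a - a)%C with (RtoC 0) by ring; apply Cmod_0).
  apply (@continuous_ext_loc C_UniformSpace C_UniformSpace (C_derive f)
    (fun z => / RtoC (2 * PI * (r / 2)) * CInt (kernel f z) 0 (2 * PI))%C a).
  - apply locally_C_Cmod. exists (r / 4). split; [lra|]. intros z Hz.
    symmetry. now apply C_derive_circle.
  - apply continuous_Cmult; [apply continuous_const|].
    apply CInt_param_continuous; [lra| |].
    + intros phi _. apply circle_jointly_continuous, ex_Cderive_continuous, Hf.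
      pose proof (Cmod_circle_le a a (r / 2) phi ltac:(lra)). lra.
    + apply locally_C_Cmod. exists (r / 4). split; [lra|]. apply kernel_path_continuous.
Qed.

End derivative.

Lemma C_derive_ex_Cderive (f : C -> C) (a : C) (r : R) :
  0 < r -> (forall z, Cmod (z - a) < r -> ex_Cderive f z) -> ex_Cderive (C_derive f) a.
Proof.
  intros Hr Hf. pose proof two_PI_pos.
  assert (Ha : Cmod (a - a) = 0) by (replace (a - a)%C with (RtoC 0) by ring; apply Cmod_0).
  eexists.
  eapply (is_Cderive_ext_loc _ _ a _ (r / 4)); [lra| |].
  { intros w Hw. symmetry. now apply (C_derive_circle f a r Hr Hf). }
  apply is_Cderive_mult; [apply is_Cderive_const|].
  apply (CInt_param_derive _ (fun z t => (C_derive f (circle z (r / 2) t) * Cexp (Ci * (- t)%R))%C)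
    0 (2 * PI) (r / 4)); try lra.
  - intros z phi Hz _. eapply is_Cderive_value.
    + apply is_Cderive_mult; [|apply is_Cderive_const].
      apply (is_Cderive_comp f (fun w => circle w (r / 2) phi)).
      * apply is_Cderive_derive, Hf.
        pose proof (Cmod_circle_le z a (r / 2) phi ltac:(lra)). lra.
      * apply is_Cderive_plus; [apply is_Cderive_id | apply is_Cderive_const].
    + cbn. ring.
  - intros z Hz. now apply (kernel_path_continuous f a r Hr Hf).
  - intros phi _. apply circle_jointly_continuous.
    apply (C_derive_continuous f _ (r / 4)); [lra|].
    intros z Hz. apply Hf.
    replace (z - a)%C with ((z - circle a (r / 2) phi) + (circle a (r / 2) phi - a))%C by ring.
    eapply Rle_lt_trans; [apply Cmod_triangle|].
    rewrite Cmod_circle; lra.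
Qed.

(** The remainder has derivative f'(w) - f'(a) - f''(a) (w - a), at most eps |w - a| because f' is
    differentiable at a; the mean value inequality integrates this bound. *)
Lemma Cderive_taylor_young (f : C -> C) (a : C) (r eps : R) :
  0 < r -> 0 < eps -> (forall z, Cmod (z - a) < r -> ex_Cderive f z) ->
  exists d, 0 < d /\ forall z, Cmod (z - a) < d ->
    Cmod (f z - f a - C_derive f a * (z - a) - C_derive (C_derive f) a / 2 * ((z - a) * (z - a)))
    <= eps * Cmod (z - a) * Cmod (z - a).
Proof.
  intros Hr He Hf.
  pose proof (is_Cderive_derive _ _ (C_derive_ex_Cderive f a r Hr Hf)) as H2.
  destruct (proj1 (is_Cderive_eps _ _ _) H2 eps He) as [d [Hd H]].
  exists (Rmin d r). split; [now apply Rmin_glb_lt|].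
  intros z Hz. pose proof (Rmin_l d r). pose proof (Rmin_r d r).
  set (l1 := C_derive f a) in *. set (l2 := C_derive (C_derive f) a) in *.
  replace (f z - f a - l1 * (z - a) - l2 / 2 * ((z - a) * (z - a)))%C
    with ((f z - l1 * (z - a) - l2 / 2 * ((z - a) * (z - a)))
          - (f a - l1 * (a - a) - l2 / 2 * ((a - a) * (a - a))))%C by ring.
  apply (Cderive_mean_value_inequality
    (fun w => f w - l1 * (w - a) - l2 / 2 * ((w - a) * (w - a)))%C
    (fun w => C_derive f w - l1 - l2 * (w - a))%C).
  - intros w Hw. assert (Hs : is_Cderive (fun w => w - a)%C w 1).
    { eapply is_Cderive_value;
        [apply is_Cderive_minus; [apply is_Cderive_id | apply is_Cderive_const]|]. ring. }
    eapply is_Cderive_value.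
    + apply is_Cderive_minus; [apply is_Cderive_minus|].
      * apply is_Cderive_derive, Hf. lra.
      * apply is_Cderive_mult; [apply is_Cderive_const | exact Hs].
      * apply is_Cderive_mult; [apply is_Cderive_const | apply is_Cderive_mult; exact Hs].
    + cbn. field.
  - intros w Hw. eapply Rle_trans; [apply H; lra|]. apply Rmult_le_compat_l; lra.
Qed.

(** Dividing the second-order expansion by z - a shows that the difference quotient has derivative
    f''(a) / 2 at a. *)
Lemma slope_ex_Cderive_diag (f : C -> C) (a : C) (r : R) :
  0 < r -> (forall z, Cmod (z - a) < r -> ex_Cderive f z) -> ex_Cderive (slope f a) a.
Proof.
  intros Hr Hf. exists (C_derive (C_derive f) a / 2)%C.
  apply is_Cderive_eps. intros eps He.
  destruct (Cderive_taylor_young f a r eps Hr He Hf) as [d [Hd H]].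
  exists d. split; auto. intros w Hw. specialize (H w Hw).
  destruct (Ceq_dec w a) as [->|Hwa].
  - rewrite slope_diag.
    replace (C_derive f a - C_derive f a - C_derive (C_derive f) a / 2 * (a - a))%C with (RtoC 0) by ring.
    rewrite Cmod_0. pose proof (Cmod_ge_0 (a - a)). nra.
  - assert (Hp : 0 < Cmod (w - a)) by (apply Cmod_gt_0; now apply Cminus_eq_contra).
    apply Rmult_le_reg_r with (Cmod (w - a)); auto.
    eapply Rle_trans; [|exact H]. rewrite <- Cmod_mult. right. f_equal.
    rewrite slope_diag, <- slope_mult. ring.
Qed.

Lemma holomorphic_disk_ball (f : C -> C) (a z : C) :
  holomorphic_on unit_disk f -> Cmod (z - a) < 1 - Cmod a -> ex_Cderive f z.
Proof.
  intros Hf Hz. apply Hf. unfold unit_disk.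
  replace z with ((z - a) + a)%C by ring.
  eapply Rle_lt_trans; [apply Cmod_triangle|]. lra.
Qed.

Lemma holomorphic_slope (f : C -> C) (a : C) :
  unit_disk a -> holomorphic_on unit_disk f -> holomorphic_on unit_disk (slope f a).
Proof.
  intros Ha Hf z Hz. destruct (Ceq_dec z a) as [->|Hza].
  - apply (slope_ex_Cderive_diag f a (1 - Cmod a)); [unfold unit_disk in Ha; lra|].
    intros w Hw. now apply (holomorphic_disk_ball f a).
  - apply slope_ex_Cderive_off_diag; auto.
Qed.

Lemma holomorphic_C_derive (f : C -> C) :
  holomorphic_on unit_disk f -> holomorphic_on unit_disk (C_derive f).
Proof.
  intros Hf a Ha. apply (C_derive_ex_Cderive f a (1 - Cmod a)); [unfold unit_disk in Ha; lra|].
  intros w Hw. now apply (holomorphic_disk_ball f a).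
Qed.

Lemma holomorphic_id : holomorphic_on unit_disk (fun z => z).
Proof. intros z _. eexists. apply is_Cderive_id. Qed.

Lemma holomorphic_const (c : C) : holomorphic_on unit_disk (fun _ => c).
Proof. intros z _. eexists. apply is_Cderive_const. Qed.

Lemma holomorphic_mult (f g : C -> C) :
  holomorphic_on unit_disk f -> holomorphic_on unit_disk g ->
  holomorphic_on unit_disk (fun z => f z * g z)%C.
Proof.
  intros Hf Hg z Hz. destruct (Hf z Hz) as [l Hl], (Hg z Hz) as [m Hm].
  eexists. apply is_Cderive_mult; eassumption.
Qed.

Lemma holomorphic_pow (f : C -> C) (n : nat) :
  holomorphic_on unit_disk f -> holomorphic_on unit_disk (fun z => (f z) ^ n)%C.
Proof.
  intros Hf. induction n as [|n IH]; cbn.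
  - apply holomorphic_const.
  - now apply holomorphic_mult.
Qed.

(** * Cauchy's formula and Schwarz's lemma *)

Lemma holomorphic_continuous (F : C -> C) (z : C) :
  holomorphic_on unit_disk F -> Cmod z < 1 -> continuous F z.
Proof. intros HF Hz. now apply ex_Cderive_continuous, HF. Qed.

Lemma Cmod_circle_0 (rho phi : R) : 0 <= rho -> Cmod (circle 0 rho phi) = rho.
Proof.
  intros H. rewrite <- (Cmod_circle 0 rho phi H) at 2. f_equal. ring.
Qed.

Lemma Cconj_mult_circle_0 (rho phi : R) :
  (circle 0 rho phi * Cconj (circle 0 rho phi))%C = RtoC (rho * rho).
Proof.
  unfold circle. rewrite Cexp_Ci. pose proof (sin2_cos2 phi) as H. unfold Rsqr in H.
  apply injective_projections; cbn; [|ring].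
  transitivity (rho * rho * (sin phi * sin phi + cos phi * cos phi)); [ring|].
  rewrite H. ring.
Qed.

Section Cauchy.
Variables (z : C) (rho : R).
Hypothesis Hrho : Cmod z < rho < 1.

Let rho_pos : 0 < rho.
Proof. pose proof (Cmod_ge_0 z). lra. Qed.

Let zeta (phi : R) : C := circle 0 rho phi.

Lemma zeta_neq (phi : R) : (zeta phi - z <> 0)%C.
Proof.
  intros H%Ceq_minus. pose proof (Cmod_circle_0 rho phi ltac:(lra)) as E.
  unfold zeta in H. rewrite H in E. lra.
Qed.

Lemma zeta_continuous (F : C -> C) (phi : R) :
  holomorphic_on unit_disk F -> continuous (fun t => F (zeta t)) phi.
Proof.
  intros HF. apply (continuous_comp zeta F); [apply circle_continuous|].
  apply holomorphic_continuous; auto. unfold zeta. rewrite Cmod_circle_0; lra.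
Qed.

Lemma cauchy_kernel_continuous (phi : R) : continuous (fun t => zeta t / (zeta t - z))%C phi.
Proof.
  apply continuous_Cdiv; [apply circle_continuous| |apply zeta_neq].
  apply continuous_Cminus; [apply circle_continuous | apply continuous_const].
Qed.

(** On |zeta| = rho the conjugate of zeta is rho^2 / zeta. So the Cauchy kernel is the conjugate of
    a function of zeta whose pole is reflected outside the circle, and to which the mean value
    property at 0 applies. *)
Lemma cauchy_kernel_reflected (phi : R) :
  (zeta phi / (zeta phi - z))%C =
  Cconj (RtoC (rho * rho) / (RtoC (rho * rho) - Cconj z * zeta phi)).
Proof.
  pose proof (Cconj_mult_circle_0 rho phi) as H. fold (zeta phi) in H.
  pose proof (zeta_neq phi) as Hn.
  assert (Hz : zeta phi <> 0).
  { apply Cmod_gt_0. unfold zeta. rewrite Cmod_circle_0; lra. }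
  assert (Hcz : Cconj (zeta phi) <> 0).
  { apply Cmod_gt_0. rewrite Cmod_conj. now apply Cmod_gt_0. }
  assert (E : (RtoC (rho * rho) - Cconj z * zeta phi)%C = (Cconj (zeta phi - z) * zeta phi)%C).
  { rewrite <- H, Cminus_conj. ring. }
  assert (Hd : Cconj (zeta phi - z) <> 0).
  { apply Cmod_gt_0. rewrite Cmod_conj. now apply Cmod_gt_0. }
  rewrite Cdiv_conj, E, <- H, !Cmult_conj, !Cconj_conj.
  - field. auto.
  - rewrite E. now apply Cmult_neq_0.
Qed.

Lemma cauchy_reflected (F : C -> C) : holomorphic_on unit_disk F ->
  CInt (fun phi => F (zeta phi) * (RtoC (rho * rho) / (RtoC (rho * rho) - Cconj z * zeta phi)))%C
    0 (2 * PI) = (2 * PI * F 0)%C.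
Proof.
  intros HF. pose proof (Cmod_ge_0 z) as Hz.
  (* A radius strictly between rho and the modulus rho^2 / |z| of the reflected pole, in a form that
     also makes sense for z = 0. *)
  set (rho1 := 2 * (rho * rho) / (rho + Cmod z)).
  assert (H1 : rho < rho1).
  { apply Rmult_lt_reg_r with (rho + Cmod z); [lra|]. unfold rho1, Rdiv.
    rewrite Rmult_assoc, Rinv_l by lra. nra. }
  assert (H2 : Cmod z * rho1 < rho * rho).
  { apply Rmult_lt_reg_r with (rho + Cmod z); [lra|]. unfold rho1, Rdiv.
    replace (Cmod z * (2 * (rho * rho) * / (rho + Cmod z)) * (rho + Cmod z))
      with (2 * (rho * rho) * Cmod z) by (field; lra).
    assert (0 < rho * rho * (rho - Cmod z)) by (apply Rmult_lt_0_compat; nra). lra. }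
  set (G := fun w => (F w * (RtoC (rho * rho) / (RtoC (rho * rho) - Cconj z * w)))%C).
  assert (HG : forall w, Cmod w < Rmin 1 rho1 -> ex_Cderive G w).
  { intros w Hw. pose proof (Rmin_l 1 rho1). pose proof (Rmin_r 1 rho1).
    destruct (HF w) as [l Hl]; [unfold unit_disk; lra|].
    eexists. apply is_Cderive_mult; [exact Hl|].
    apply is_Cderive_div; [apply is_Cderive_const| |].
    - apply is_Cderive_minus; [apply is_Cderive_const|].
      apply is_Cderive_mult; [apply is_Cderive_const | apply is_Cderive_id].
    - intros E%Ceq_minus. apply (f_equal Cmod) in E.
      rewrite Cmod_mult, Cmod_conj, Cmod_R, Rabs_pos_eq in E by nra.
      pose proof (Cmod_ge_0 w). nra. }
  assert (Hmin : rho < Rmin 1 rho1) by (apply Rmin_glb_lt; lra).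
  change (CInt (fun phi => G (circle 0 rho phi)) 0 (2 * PI) = (2 * PI * F 0)%C).
  rewrite (circle_mean_value G 0 rho (Rmin 1 rho1)).
  - unfold G. replace (RtoC (rho * rho) - Cconj z * 0)%C with (RtoC (rho * rho)) by ring.
    field. intros E. apply RtoC_inj in E. nra.
  - lra.
  - apply ex_Cderive_continuous, HG. rewrite Cmod_0. lra.
  - intros w Hw. apply HG. replace w with (w - 0)%C by ring. lra.
Qed.

(** The conjugate of [cauchy_reflected] for F = 1. *)
Lemma cauchy_kernel_integral : CInt (fun phi => zeta phi / (zeta phi - z))%C 0 (2 * PI) = (2 * PI)%C.
Proof.
  pose proof two_PI_pos as Hpi.
  pose proof (cauchy_reflected (fun _ => 1) (holomorphic_const 1)) as H.
  apply (f_equal Cconj) in H. rewrite <- CInt_conj in H; [| lra |].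
  - rewrite (CInt_ext 0 (2 * PI) ltac:(lra) _ (fun phi => zeta phi / (zeta phi - z))%C) in H.
    + rewrite H. apply injective_projections; cbn; ring.
    + intros phi _. rewrite cauchy_kernel_reflected. now rewrite Cmult_1_l.
  - intros phi _. apply continuous_ext with (fun phi => Cconj (zeta phi / (zeta phi - z))%C).
    + intros t. now rewrite cauchy_kernel_reflected, Cconj_conj, Cmult_1_l.
    + apply continuous_Cconj, cauchy_kernel_continuous.
Qed.

(** The function w (F w - F z) / (w - z) vanishes at 0, so its mean over the circle is 0; there it
    equals (F - F z) times the kernel. *)
Lemma cauchy_formula (F : C -> C) : holomorphic_on unit_disk F ->
  CInt (fun phi => F (zeta phi) * (zeta phi / (zeta phi - z)))%C 0 (2 * PI) = (2 * PI * F z)%C.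
Proof.
  intros HF. pose proof two_PI_pos as Hpi.
  assert (Hz : unit_disk z) by (unfold unit_disk; lra).
  assert (HS : holomorphic_on unit_disk (fun w => slope F z w * w)%C).
  { apply holomorphic_mult; [now apply holomorphic_slope | apply holomorphic_id]. }
  assert (E : CInt (fun phi => slope F z (zeta phi) * zeta phi)%C 0 (2 * PI) = 0).
  { unfold zeta. rewrite (circle_mean_value (fun w => slope F z w * w)%C 0 rho 1); [ring|lra| |].
    - apply holomorphic_continuous; auto. rewrite Cmod_0. lra.
    - intros w Hw. apply HS. unfold unit_disk. replace w with (w - 0)%C by ring. lra. }
  rewrite (CInt_ext 0 (2 * PI) ltac:(lra) _
    (fun phi => F (zeta phi) * (zeta phi / (zeta phi - z)) - F z * (zeta phi / (zeta phi - z)))%C) in E.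
  - rewrite CInt_minus, CInt_scal, cauchy_kernel_integral in E; try lra.
    + apply Ceq_minus in E. rewrite E. ring.
    + intros t _. apply cauchy_kernel_continuous.
    + intros t _. apply continuous_Cmult; [now apply zeta_continuous | apply cauchy_kernel_continuous].
    + intros t _. apply continuous_Cmult; [apply continuous_const | apply cauchy_kernel_continuous].
  - intros phi _. pose proof (zeta_neq phi) as Hn.
    rewrite slope_off_diag by (intros E'; apply Hn; rewrite E'; ring). field. auto.
Qed.

(** The companion of Cauchy's formula: adding the two replaces F by 2 Re F on the circle, which is
    how Schwarz's integral formula arises. *)
Lemma cauchy_formula_conj (F : C -> C) : holomorphic_on unit_disk F ->
  CInt (fun phi => Cconj (F (zeta phi)) * (zeta phi / (zeta phi - z)))%C 0 (2 * PI) =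
  (2 * PI * Cconj (F 0))%C.
Proof.
  intros HF. pose proof two_PI_pos as Hpi.
  pose proof (cauchy_reflected F HF) as H. apply (f_equal Cconj) in H.
  rewrite <- CInt_conj in H; [| lra |].
  - rewrite !Cmult_conj in H.
    replace (Cconj 2) with (RtoC 2) in H by (apply injective_projections; cbn; ring).
    replace (Cconj PI) with (RtoC PI) in H by (apply injective_projections; cbn; ring).
    rewrite <- H. apply CInt_ext; [lra|].
    intros t _. now rewrite Cmult_conj, cauchy_kernel_reflected.
  - intros t _. apply continuous_Cmult; [now apply zeta_continuous|].
    apply continuous_ext with (fun phi => Cconj (zeta phi / (zeta phi - z))%C).
    + intros s. now rewrite cauchy_kernel_reflected, Cconj_conj.
    + apply continuous_Cconj, cauchy_kernel_continuous.
Qed.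

Lemma cauchy_estimate (F : C -> C) (K : R) : holomorphic_on unit_disk F ->
  (forall w, Cmod w = rho -> Cmod (F w) <= K) -> Cmod (F z) <= K * (rho / (rho - Cmod z)).
Proof.
  intros HF HK. pose proof two_PI_pos as Hpi. pose proof (cauchy_formula F HF) as H.
  apply (f_equal Cmod) in H.
  assert (Hle : Cmod (CInt (fun phi => F (zeta phi) * (zeta phi / (zeta phi - z)))%C 0 (2 * PI))
    <= (2 * PI - 0) * (K * (rho / (rho - Cmod z)))).
  { apply Cmod_CInt_le; [lra| |].
    - intros t _. apply continuous_Cmult; [now apply zeta_continuous | apply cauchy_kernel_continuous].
    - intros t _. rewrite Cmod_mult. apply Rmult_le_compat; try apply Cmod_ge_0.
      + apply HK. unfold zeta. apply Cmod_circle_0. lra.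
      + rewrite Cmod_div by apply zeta_neq.
        pose proof (Cmod_triangle_lower (zeta t) z) as Hl.
        assert (E : Cmod (zeta t) = rho) by (apply Cmod_circle_0; lra).
        rewrite E in *. apply Rmult_le_compat_l; [lra|]. apply Rinv_le_contravar; lra. }
  rewrite H, <- RtoC_mult, Cmod_mult, Cmod_R, Rabs_pos_eq in Hle by lra.
  apply Rmult_le_reg_l with (2 * PI); lra.
Qed.

End Cauchy.

Lemma le_of_pow_le (x y c : R) : 0 <= x -> 0 <= y -> (forall n, x ^ n <= c * y ^ n) -> x <= y.
Proof.
  intros Hx Hy H. apply Rnot_lt_le. intros Hlt.
  destruct (Rle_lt_or_eq_dec _ _ Hy) as [Hy0 | Hy0].
  - destruct (Pow_x_infinity (x / y)) with (b := c + 1) as [N HN].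
    { rewrite Rabs_pos_eq by (apply Rdiv_le_0_compat; lra).
      apply Rmult_lt_reg_r with y; auto. unfold Rdiv. rewrite Rmult_assoc, Rinv_l; lra. }
    specialize (HN N (le_n _)). specialize (H N).
    assert (HyN : 0 < y ^ N) by now apply pow_lt.
    rewrite Rabs_pos_eq in HN by (apply pow_le, Rdiv_le_0_compat; lra).
    unfold Rdiv in HN. rewrite Rpow_mult_distr, pow_inv in HN.
    apply Rge_le, Rmult_le_compat_r with (r := y ^ N) in HN; [|lra].
    rewrite Rmult_assoc, Rinv_l in HN; lra.
  - subst y. specialize (H 1%nat). cbn in H. lra.
Qed.

(* Cauchy's estimate for the powers of [F]; the constant disappears after taking n-th roots. *)
Lemma maximum_modulus (F : C -> C) (z : C) (rho K : R) :
  Cmod z < rho < 1 -> holomorphic_on unit_disk F ->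
  (forall w, Cmod w = rho -> Cmod (F w) <= K) -> Cmod (F z) <= K.
Proof.
  intros Hrho HF HK. pose proof (Cmod_ge_0 z).
  apply le_of_pow_le with (rho / (rho - Cmod z)).
  - apply Cmod_ge_0.
  - eapply Rle_trans; [apply Cmod_ge_0 | apply (HK rho)]. rewrite Cmod_R. apply Rabs_pos_eq. lra.
  - intros n. rewrite <- Cmod_pow, Rmult_comm.
    apply (cauchy_estimate z rho Hrho (fun w => F w ^ n)%C); [now apply holomorphic_pow|].
    intros w Hw. rewrite Cmod_pow. apply pow_incr. split; [apply Cmod_ge_0 | auto].
Qed.

(** The maximum principle for g(w) / w on |w| = rho gives |g z| rho <= |z|; then rho tends to 1. *)
Lemma schwarz (g : C -> C) (z : C) :
  holomorphic_on unit_disk g -> g 0 = 0 -> (forall w, unit_disk w -> unit_disk (g w)) ->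
  unit_disk z -> Cmod (g z) <= Cmod z.
Proof.
  intros Hg H0 Hgd Hz.
  assert (H00 : unit_disk 0) by (unfold unit_disk; rewrite Cmod_0; lra).
  pose proof (Cmod_ge_0 z) as Hz0. unfold unit_disk in Hz.
  assert (H : forall rho, Cmod z < rho < 1 -> Cmod (g z) * rho <= Cmod z).
  { intros rho Hrho.
    assert (B : Cmod (slope g 0 z) <= / rho).
    { apply (maximum_modulus (slope g 0) z rho); auto; [now apply holomorphic_slope|].
      intros w Hw. assert (Hw0 : w <> 0) by (apply Cmod_gt_0; lra).
      rewrite slope_off_diag, H0 by auto.
      replace (g w - 0)%C with (g w) by ring. replace (w - 0)%C with w by ring.
      rewrite Cmod_div, Hw by auto.
      rewrite <- (Rmult_1_l (/ rho)). apply Rmult_le_compat_r.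
      - left. apply Rinv_0_lt_compat. lra.
      - left. apply Hgd. unfold unit_disk. lra. }
    replace (g z) with (slope g 0 z * z)%C.
    - rewrite Cmod_mult.
      assert (Cmod (slope g 0 z) * rho <= 1).
      { apply Rmult_le_reg_r with (/ rho); [apply Rinv_0_lt_compat; lra|].
        rewrite Rmult_assoc, Rinv_r by lra. lra. }
      replace (Cmod (slope g 0 z) * Cmod z * rho) with (Cmod (slope g 0 z) * rho * Cmod z) by ring.
      nra.
    - replace (slope g 0 z * z)%C with (slope g 0 z * (z - 0))%C by ring.
      rewrite slope_mult, H0. ring. }
  apply le_epsilon. intros eps He.
  (* The second bound keeps 1 - e above |z|; as |g z| < 1, replacing rho = 1 - e by 1 costs at most
     e. *)
  set (e := Rmin eps ((1 - Cmod z) / 2)).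
  assert (0 < e) by (apply Rmin_glb_lt; lra).
  assert (e <= eps) by apply Rmin_l. assert (e <= (1 - Cmod z) / 2) by apply Rmin_r.
  specialize (H (1 - e) ltac:(lra)).
  pose proof (Hgd z Hz) as Hgz. unfold unit_disk in Hgz. pose proof (Cmod_ge_0 (g z)). nra.
Qed.

(** * Univalent functions *)

Lemma circle_surjective (a z : C) (rho : R) :
  0 < rho -> Cmod (z - a) = rho -> exists phi, 0 <= phi <= 2 * PI /\ z = circle a rho phi.
Proof.
  intros Hr Hz. destruct (circle_param rho (z - a) Hr Hz) as [t [Ht E]].
  exists t. split; auto. unfold circle. rewrite Cexp_Ci.
  replace z with (a + (z - a))%C by ring. rewrite E.
  apply injective_projections; cbn; ring.
Qed.

Lemma circle_lower_bound (G : C -> C) (a : C) (rho : R) :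
  0 < rho -> (forall z, Cmod (z - a) = rho -> continuous G z /\ G z <> 0) ->
  exists m, 0 < m /\ forall z, Cmod (z - a) = rho -> m <= Cmod (G z).
Proof.
  intros Hr HG. pose proof two_PI_pos.
  destruct (continuity_ab_min (fun phi => Cmod (G (circle a rho phi))) 0 (2 * PI)) as [t [Hmin Ht]].
  - lra.
  - intros c Hc. apply continuity_pt_filterlim.
    apply (continuous_Cmod (fun phi => G (circle a rho phi)) c).
    apply (continuous_comp (circle a rho) G); [apply circle_continuous|].
    apply HG, Cmod_circle; lra.
  - exists (Cmod (G (circle a rho t))). split.
    + apply Cmod_gt_0, HG, Cmod_circle; lra.
    + intros z Hz. destruct (circle_surjective a z rho Hr Hz) as [phi [Hphi ->]]. now apply Hmin.
Qed.

(** The mean value bound applied to 1 / F. *)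
Lemma minimum_modulus_center (F : C -> C) (a : C) (rho rho0 m : R) :
  0 < rho < rho0 -> 0 < m -> continuous F a ->
  (forall z, 0 < Cmod (z - a) < rho0 -> ex_Cderive F z) ->
  (forall z, Cmod (z - a) < rho0 -> F z <> 0) ->
  (forall z, Cmod (z - a) = rho -> m <= Cmod (F z)) -> m <= Cmod (F a).
Proof.
  intros Hr Hm Ha HF H0 HK.
  assert (Ha0 : F a <> 0).
  { apply H0. replace (a - a)%C with (RtoC 0) by ring. rewrite Cmod_0. lra. }
  assert (H : Cmod (/ F a) <= / m).
  { apply (circle_mean_le (fun z => / F z)%C a rho rho0); auto.
    - now apply continuous_Cinv.
    - intros z Hz. destruct (HF z Hz) as [l Hl]. eexists.
      apply is_Cderive_comp; [apply is_Cderive_Cinv, H0; lra | exact Hl].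
    - intros z Hz. rewrite Cmod_inv by (apply H0; lra).
      apply Rinv_le_contravar; auto. }
  rewrite Cmod_inv in H by auto.
  apply Cmod_gt_0 in Ha0. apply Rnot_lt_le. intros Hlt.
  apply Rinv_lt_contravar in Hlt; [lra | nra].
Qed.

(** Carathéodory's criterion. It suits inverse functions, where the candidate phi is a quotient of
    two values of [slope]. *)
Lemma caratheodory_derivative (f phi : C -> C) (z : C) :
  continuous phi z -> (forall w, unit_disk w -> (f w - f z)%C = (phi w * (w - z))%C) ->
  unit_disk z -> is_Cderive f z (phi z).
Proof.
  intros Hc H Hz. apply is_Cderive_eps. intros eps He.
  destruct (proj1 (locally_C_Cmod _ _) (proj1 (continuous_C_eps _ _) Hc eps He)) as [d [Hd Hd']].
  unfold unit_disk in *.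
  exists (Rmin d (1 - Cmod z)). split; [apply Rmin_glb_lt; lra|].
  intros w Hw. pose proof (Rmin_l d (1 - Cmod z)). pose proof (Rmin_r d (1 - Cmod z)).
  assert (Hwd : Cmod w < 1).
  { replace w with ((w - z) + z)%C by ring. eapply Rle_lt_trans; [apply Cmod_triangle|]. lra. }
  rewrite H by auto.
  replace (phi w * (w - z) - phi z * (w - z))%C with ((phi w - phi z) * (w - z))%C by ring.
  rewrite Cmod_mult. apply Rmult_le_compat_r; [apply Cmod_ge_0|]. left. apply Hd'. lra.
Qed.

Section univalent.
Variable f : C -> C.
Hypotheses (Hf : holomorphic_on unit_disk f) (Hinj : injective_on unit_disk f).

Lemma ball_in_disk (a z : C) : Cmod (z - a) < 1 - Cmod a -> unit_disk z.
Proof.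
  intros H. unfold unit_disk. replace z with ((z - a) + a)%C by ring.
  eapply Rle_lt_trans; [apply Cmod_triangle|]. lra.
Qed.

(* Hurwitz: for zeta close to a, the zero-free function [slope f zeta] is
   bounded below on a circle around zeta, hence at its centre, where its value
   is f'(zeta), unless f'(zeta) = 0; so f'(a) = 0 forces f' = 0 near a. *)
Lemma univalent_derive_neq_0 (a : C) : unit_disk a -> C_derive f a <> 0.
Proof.
  intros Ha E. pose proof two_PI_pos as Hpi. pose proof (Cmod_ge_0 a) as Ha0.
  set (rho := (1 - Cmod a) / 4).
  assert (Hrho : 0 < rho) by (unfold rho, unit_disk in *; lra).
  assert (Eaa : Cmod (a - a) = 0) by (replace (a - a)%C with (RtoC 0) by ring; apply Cmod_0).
  assert (Hball : forall z, Cmod (z - a) < 4 * rho -> unit_disk z).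
  { intros z Hz. apply (ball_in_disk a). unfold rho in Hz. lra. }
  destruct (circle_lower_bound (fun z => f z - f a)%C a rho Hrho) as [m [Hm Hlow]].
  { intros z Hz. assert (Hzd : unit_disk z) by (apply Hball; lra). split.
    - apply continuous_Cminus; [now apply holomorphic_continuous | apply continuous_const].
    - apply Cminus_eq_contra. intros E'. apply Hinj in E'; auto. subst z. lra. }
  assert (Hu := jointly_continuous_uniform
    (fun (z : C_UniformSpace) t => f (circle z rho t) - f z)%C 0 (2 * PI) (m / 2) a ltac:(lra)).
  lapply Hu; clear Hu.
  2: { intros phi _. apply continuous_Cminus.
    - apply (continuous_comp (fun p : C_UniformSpace * R => circle (fst p) rho (snd p)) f).
      + apply continuous_Cplus; [apply continuous_fst|].
        apply continuous_Cmult; [apply continuous_const|].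
        apply continuous_Cexp, continuous_Cmult; [apply continuous_const|].
        apply continuous_RtoC, continuous_snd.
      + apply holomorphic_continuous; auto. apply Hball. cbn.
        pose proof (Cmod_circle_le a a rho phi ltac:(lra)). lra.
    - apply (continuous_comp (fun p : C_UniformSpace * R => fst p) f); [apply continuous_fst|].
      now apply holomorphic_continuous. }
  intros Hu. apply locally_C_Cmod in Hu. destruct Hu as [d1 [Hd1 Hu]].
  assert (Hcd : continuous (C_derive f) a).
  { apply holomorphic_continuous; auto. now apply holomorphic_C_derive. }
  assert (Hc0 : 0 < m / 2 / rho) by (apply Rdiv_lt_0_compat; lra).
  destruct (proj1 (locally_C_Cmod _ _) (proj1 (continuous_C_eps _ _) Hcd _ Hc0)) as [d2 [Hd2 Hcd']].
  set (d := Rmin (Rmin d1 d2) rho).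
  assert (Hd : 0 < d) by (repeat apply Rmin_glb_lt; auto).
  assert (Hdd : d <= d1 /\ d <= d2 /\ d <= rho).
  { unfold d. pose proof (Rmin_l (Rmin d1 d2) rho). pose proof (Rmin_r (Rmin d1 d2) rho).
    pose proof (Rmin_l d1 d2). pose proof (Rmin_r d1 d2). lra. }
  assert (Hzero : forall z, Cmod (z - a) < d -> C_derive f z = 0).
  { intros z Hz. apply NNPP. intros Hnz.
    assert (Hzd : unit_disk z) by (apply Hball; lra).
    specialize (Hcd' z ltac:(lra)). rewrite E in Hcd'.
    replace (C_derive f z - 0)%C with (C_derive f z) in Hcd' by ring.
    assert (H : m / 2 / rho <= Cmod (slope f z z)).
    { assert (Hzb : forall w, Cmod (w - z) < 3 * rho -> unit_disk w).
      { intros w Hw. apply Hball. replace (w - a)%C with ((w - z) + (z - a))%C by ring.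
        eapply Rle_lt_trans; [apply Cmod_triangle|]. lra. }
      apply (minimum_modulus_center (slope f z) z rho (3 * rho)); auto; [lra| | | |].
      - now apply slope_continuous, Hf.
      - intros w Hw. apply slope_ex_Cderive_off_diag; [now apply Cmod_pos_neq|].
        apply Hf, Hzb. lra.
      - intros w Hw. destruct (Ceq_dec w z) as [->|Hwz]; [now rewrite slope_diag|].
        intros E'. pose proof (slope_mult f z w) as Hs. rewrite E', Cmult_0_l in Hs.
        symmetry in Hs. apply Ceq_minus in Hs. apply Hinj in Hs; auto.
      - intros w Hw. assert (Hwz : w <> z) by (apply Cmod_pos_neq; lra).
        rewrite slope_off_diag by auto.
        rewrite Cmod_div by now apply Cminus_eq_contra.
        rewrite Hw. apply Rmult_le_compat_r; [left; now apply Rinv_0_lt_compat|].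
        destruct (circle_surjective z w rho Hrho Hw) as [phi [Hphi ->]].
        specialize (Hu z ltac:(lra) phi Hphi).
        pose proof (Hlow (circle a rho phi) (Cmod_circle a rho phi ltac:(lra))) as Hl.
        pose proof (Cmod_triangle_lower (f (circle a rho phi) - f a)
          ((f (circle a rho phi) - f a) - (f (circle z rho phi) - f z))) as Ht.
        replace (f (circle a rho phi) - f a - (f (circle a rho phi) - f a - (f (circle z rho phi) - f z)))%C
          with (f (circle z rho phi) - f z)%C in Ht by ring.
        rewrite (Cmod_minus_sym (f (circle a rho phi) - f a)) in Ht. lra. }
    rewrite slope_diag in H. lra. }
  set (b := (a + (d / 2)%R)%C).
  assert (Hb : Cmod (b - a) = d / 2).
  { unfold b. replace (a + (d / 2)%R - a)%C with (RtoC (d / 2)) by ring.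
    rewrite Cmod_R, Rabs_pos_eq; lra. }
  assert (Hba : f b = f a).
  { apply Ceq_minus, Cmod_eq_0, Rle_antisym; [|apply Cmod_ge_0].
    rewrite <- (Rmult_0_l (Cmod (b - a))).
    apply (Cderive_mean_value_inequality f (C_derive f)).
    - intros w Hw. apply is_Cderive_derive, Hf, Hball. lra.
    - intros w Hw. rewrite Hzero, Cmod_0; lra. }
  apply Hinj in Hba; auto.
  - rewrite Hba, Eaa in Hb. lra.
  - apply Hball. lra.
Qed.

Lemma univalent_slope_neq_0 (a z : C) : unit_disk a -> unit_disk z -> slope f a z <> 0.
Proof.
  intros Ha Hz. destruct (Ceq_dec z a) as [->|Hza].
  - rewrite slope_diag. now apply univalent_derive_neq_0.
  - intros E. pose proof (slope_mult f a z) as H. rewrite E, Cmult_0_l in H.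
    symmetry in H. apply Ceq_minus in H. apply Hinj in H; auto.
Qed.

(** If f z were close to f a with z far from a, then f - f z would be zero-free near a and at least
    m / 2 on a circle around a, yet smaller than m / 2 at the centre. *)
Lemma univalent_inverse_continuous (a : C) (eps : R) : unit_disk a -> 0 < eps ->
  exists d, 0 < d /\ forall z, unit_disk z -> Cmod (f z - f a) < d -> Cmod (z - a) < eps.
Proof.
  intros Ha He. unfold unit_disk in Ha.
  set (rho0 := Rmin eps (1 - Cmod a)).
  assert (H0 : 0 < rho0) by (apply Rmin_glb_lt; lra).
  assert (H1 : rho0 <= eps) by apply Rmin_l.
  assert (H2 : rho0 <= 1 - Cmod a) by apply Rmin_r.
  assert (Hb : forall z, Cmod (z - a) < rho0 -> unit_disk z).
  { intros z Hz. apply (ball_in_disk a). lra. }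
  destruct (circle_lower_bound (fun z => f z - f a)%C a (rho0 / 2)) as [m [Hm Hlow]]; [lra| |].
  { intros z Hz. assert (Hzd : unit_disk z) by (apply Hb; lra). split.
    - apply continuous_Cminus; [now apply holomorphic_continuous | apply continuous_const].
    - apply Cminus_eq_contra. intros E'. apply Hinj in E'; auto. subst z.
      replace (a - a)%C with (RtoC 0) in Hz by ring. rewrite Cmod_0 in Hz. lra. }
  exists (m / 2). split; [lra|]. intros z Hz Hfz.
  apply Rnot_le_lt. intros Hle.
  assert (H : m / 2 <= Cmod (f a - f z)).
  { apply (minimum_modulus_center (fun w => f w - f z)%C a (rho0 / 2) rho0); try lra.
    - apply continuous_Cminus; [now apply holomorphic_continuous | apply continuous_const].
    - intros w Hw. destruct (Hf w) as [l Hl]; [apply Hb; lra|].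
      eexists. apply is_Cderive_minus; [exact Hl | apply is_Cderive_const].
    - intros w Hw. apply Cminus_eq_contra. intros E'. apply Hinj in E'; auto.
      subst w. lra.
    - intros w Hw. specialize (Hlow w Hw).
      pose proof (Cmod_triangle_lower (f w - f a) (f z - f a)) as Ht.
      replace (f w - f a - (f z - f a))%C with (f w - f z)%C in Ht by ring. lra. }
  rewrite Cmod_minus_sym in H. lra.
Qed.

(** Here g is f^{-1}(c f). It is continuous because f^{-1} is, and f (g w) - f (g z) = c (f w - f z)
    exhibits g w - g z as a continuous factor times w - z, the denominator being a nonzero slope of
    f. *)
Lemma univalent_conjugate_holomorphic (g : C -> C) (c : C) :
  (forall z, unit_disk z -> unit_disk (g z)) ->
  (forall z, unit_disk z -> f (g z) = (c * f z)%C) -> holomorphic_on unit_disk g.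
Proof.
  intros Hg Hfg z Hz.
  assert (Hgc : continuous g z).
  { apply continuous_C_eps. intros eps He. apply locally_C_Cmod.
    destruct (univalent_inverse_continuous (g z) eps (Hg z Hz) He) as [d [Hd H]].
    assert (Hc : continuous (fun w => c * f w)%C z).
    { apply continuous_Cmult; [apply continuous_const | now apply holomorphic_continuous]. }
    destruct (proj1 (locally_C_Cmod _ _) (proj1 (continuous_C_eps _ _) Hc d Hd)) as [d2 [Hd2 H2]].
    unfold unit_disk in Hz.
    exists (Rmin d2 (1 - Cmod z)). split; [apply Rmin_glb_lt; lra|].
    intros w Hw. pose proof (Rmin_l d2 (1 - Cmod z)). pose proof (Rmin_r d2 (1 - Cmod z)).
    assert (Hwd : unit_disk w) by (apply (ball_in_disk z); lra).
    apply H; [now apply Hg|]. rewrite !Hfg by auto. apply H2. lra. }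
  eexists. apply (caratheodory_derivative g (fun w => c * slope f z w / slope f (g z) (g w))%C); auto.
  - apply continuous_Cdiv.
    + apply continuous_Cmult; [apply continuous_const|]. now apply slope_continuous, Hf.
    + apply (continuous_comp g (slope f (g z))); auto. now apply slope_continuous, Hf, Hg.
    + apply univalent_slope_neq_0; now apply Hg.
  - intros w Hw.
    assert (Hn : slope f (g z) (g w) <> 0) by (apply univalent_slope_neq_0; now apply Hg).
    replace (c * slope f z w / slope f (g z) (g w) * (w - z))%C
      with (c * (slope f z w * (w - z)) / slope f (g z) (g w))%C by (field; auto).
    rewrite slope_mult.
    replace (c * (f w - f z))%C with (f (g w) - f (g z))%C by (rewrite !Hfg by auto; ring).
    rewrite <- (slope_mult f (g z) (g w)). field. auto.
Qed.

End univalent.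

(** * Spirallike functions *)

Lemma unit_disk_0 : unit_disk 0.
Proof. unfold unit_disk. rewrite Cmod_0. lra. Qed.

(* Schwarz's lemma for f^{-1} o (multiplication by e^{t e^{i lambda}}) o f. *)
Lemma spirallike_contraction (lambda t : R) (f : C -> C) (z : C) :
  spirallike lambda f -> t <= 0 -> unit_disk z ->
  exists u, unit_disk u /\ f u = (f z * Cexp (t * Cexp (Ci * lambda)))%C /\ Cmod u <= Cmod z.
Proof.
  intros (Hf & Hf0 & Hinj & _ & _ & Hsp) Ht Hz.
  set (c := Cexp (t * Cexp (Ci * lambda))).
  assert (H : forall w, exists u, unit_disk w -> unit_disk u /\ f u = (c * f w)%C).
  { intros w. destruct (classic (unit_disk w)) as [Hw | Hw].
    - destruct (Hsp (f w) (ex_intro _ w (conj Hw eq_refl)) (f w * c)%C) as [u [Hu Eu]].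
      + left. now exists t.
      + exists u. intros _. split; auto. rewrite Eu. ring.
    - exists 0. intros Hw'. contradiction. }
  pose (g := fun w => proj1_sig (constructive_indefinite_description _ (H w))).
  assert (Hg : forall w, unit_disk w -> unit_disk (g w) /\ f (g w) = (c * f w)%C).
  { intros w. exact (proj2_sig (constructive_indefinite_description _ (H w))). }
  exists (g z). split; [now apply Hg|]. split; [rewrite (proj2 (Hg z Hz)); ring|].
  apply schwarz; auto.
  - apply (univalent_conjugate_holomorphic f Hf Hinj g c); intros w Hw; now apply Hg.
  - pose proof unit_disk_0 as H0. destruct (Hg 0 H0) as [Hg1 Hg2].
    apply Hinj; auto. rewrite Hg2, Hf0. ring.
  - intros w Hw. now apply Hg.
Qed.

(** Expanding |z + s|^2 leaves 2 Re (conj z s) + |s|^2 <= 0. *)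
Lemma Re_Cconj_mult_le (z s : C) : Cmod (z + s) <= Cmod z -> Re (Cconj z * s) <= 0.
Proof.
  intros H. pose proof (Cmod_ge_0 (z + s)).
  pose proof (Cmod2_alt (z + s)) as E1. pose proof (Cmod2_alt z) as E2.
  assert (Hs : Cmod (z + s) ^ 2 <= Cmod z ^ 2) by (apply pow_incr; lra).
  destruct z as [x y], s as [u v]. rewrite E1, E2 in Hs. cbn in *. nra.
Qed.

Lemma C_derive_Cexp_0 : C_derive Cexp 0 = 1.
Proof. apply is_C_derive_unique, is_Cderive_Cexp_0. Qed.

(** The contracted point u satisfies conj z (u - z) = t H(t e, u), where H is built from the slopes
    of exp and f and is continuous at (0, z). Since t < 0 and |u| <= |z|, Re H >= 0 at (t e, u). If
    Re H were negative at (0, z), a small t would contradict this. No path t -> u has to be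
    differentiated. *)
Lemma spirallike_infinitesimal (lambda : R) (f : C -> C) (z : C) :
  spirallike lambda f -> unit_disk z ->
  0 <= Re (Cconj z * (Cexp (Ci * lambda) * f z / C_derive f z)).
Proof.
  intros Hs Hz. pose proof Hs as (Hf & _ & Hinj & _).
  set (e := Cexp (Ci * lambda)).
  assert (He : Cmod e = 1) by apply Cmod_Cexp_Ci.
  pose (H := fun p : C_UniformSpace * C_UniformSpace =>
    (Cconj z * (e * slope Cexp 0 (fst p) * f z / slope f z (snd p)))%C).
  assert (Hc : continuous H (RtoC 0, z)).
  { apply continuous_Cmult; [apply continuous_const|].
    apply continuous_Cdiv.
    - apply continuous_Cmult; [|apply continuous_const].
      apply continuous_Cmult; [apply continuous_const|].
      apply (continuous_comp fst (slope Cexp 0)); [apply continuous_fst|].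
      apply slope_continuous. eexists. apply is_Cderive_Cexp.
    - apply (continuous_comp snd (slope f z)); [apply continuous_snd|].
      now apply slope_continuous, Hf.
    - now apply univalent_slope_neq_0. }
  assert (E0 : H (RtoC 0, z) = (Cconj z * (e * f z / C_derive f z))%C).
  { unfold H. cbn [fst snd]. rewrite !slope_diag, C_derive_Cexp_0, Cmult_1_r. reflexivity. }
  rewrite <- E0. apply Rnot_lt_le. intros Hneg.
  destruct (proj1 (continuous_C_eps H (RtoC 0, z)) Hc (- Re (H (RtoC 0, z)))) as [d Hd]; [lra|].
  pose proof (cond_pos d) as Hdp.
  destruct (univalent_inverse_continuous f Hf Hinj z d Hz Hdp) as [d1 [Hd1 Hinv]].
  assert (Hcont : continuous (fun t : R => f z * Cexp (t * e))%C 0).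
  { apply continuous_Cmult; [apply continuous_const|].
    apply continuous_Cexp, continuous_Cmult; [|apply continuous_const].
    apply continuous_RtoC, continuous_id. }
  destruct (proj1 (continuous_C_eps _ _) Hcont d1 Hd1) as [d2 Hd2].
  pose proof (cond_pos d2) as Hd2p.
  set (t := - (Rmin d d2 / 2)).
  assert (Hmin : 0 < Rmin d d2) by now apply Rmin_glb_lt.
  assert (Ht : t < 0) by (unfold t; lra).
  assert (Hta : Rabs t < d /\ Rabs t < d2).
  { rewrite Rabs_left by auto. unfold t. pose proof (Rmin_l d d2). pose proof (Rmin_r d d2). lra. }
  destruct (spirallike_contraction lambda t f z Hs ltac:(lra) Hz) as [u [Hu [Efu Hle]]].
  fold e in Efu.
  assert (Huz : Cmod (u - z) < d).
  { apply Hinv; auto. rewrite Efu.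
    assert (Hb : ball 0 d2 t).
    { change (Rabs (t - 0) < d2). rewrite Rminus_0_r. apply Hta. }
    specialize (Hd2 t Hb). replace (RtoC 0 * e)%C with (RtoC 0) in Hd2 by ring.
    now rewrite Cexp_0, Cmult_1_r in Hd2. }
  assert (Hte : Cmod (t * e - 0) < d).
  { replace (t * e - 0)%C with (t * e)%C by ring. rewrite Cmod_mult, He, Cmod_R. lra. }
  assert (Hclose : Cmod (H ((t * e)%C, u) - H (RtoC 0, z)) < - Re (H (RtoC 0, z))).
  { apply Hd. split; now apply ball_C_Cmod. }
  assert (HRe : Re (H ((t * e)%C, u)) < 0).
  { pose proof (re_le_Cmod (H ((t * e)%C, u) - H (RtoC 0, z))) as Hr.
    unfold Cminus in Hr. rewrite re_plus, re_opp in Hr.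
    pose proof (Rle_abs (Re (H ((t * e)%C, u)) + - Re (H (RtoC 0, z)))).
    unfold Cminus in Hclose. lra. }
  assert (Hn : slope f z u <> 0) by now apply univalent_slope_neq_0.
  assert (Es : (Cconj z * (u - z) = t * H ((t * e)%C, u))%C).
  { unfold H. cbn [fst snd].
    pose proof (slope_mult Cexp 0 (t * e)) as E1. rewrite Cexp_0 in E1.
    pose proof (slope_mult f z u) as E2. rewrite Efu in E2.
    replace (f z * Cexp (t * e) - f z)%C with (f z * (Cexp (t * e) - 1))%C in E2 by ring.
    rewrite <- E1 in E2.
    replace (u - z)%C with (slope f z u * (u - z) / slope f z u)%C by (field; auto).
    rewrite E2. field. auto. }
  assert (Hlast : Re (Cconj z * (u - z)) <= 0).
  { apply Re_Cconj_mult_le. replace (z + (u - z))%C with u by ring. exact Hle. }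
  rewrite Es, re_scal_l in Hlast. nra.
Qed.

(* z f'(z) / f(z), with its limit value 1 at z = 0. *)
Definition spiral_ratio (f : C -> C) (z : C) : C := (C_derive f z / slope f 0 z)%C.

Section spirallike.
Variables (lambda : R) (f : C -> C).
Hypotheses (Hlambda : - (PI / 2) < lambda < PI / 2) (Hs : spirallike lambda f).

Let Hf : holomorphic_on unit_disk f := proj1 Hs.
Let Hinj : injective_on unit_disk f := proj1 (proj2 (proj2 Hs)).

Lemma cos_lambda_pos : 0 < cos lambda.
Proof. apply cos_gt_0; apply Hlambda. Qed.

Lemma spiral_ratio_mult (z : C) : unit_disk z -> (z * C_derive f z = f z * spiral_ratio f z)%C.
Proof.
  intros Hz. unfold spiral_ratio.
  assert (Hn : slope f 0 z <> 0)
    by (apply univalent_slope_neq_0; auto; apply unit_disk_0).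
  pose proof (slope_mult f 0 z) as E. rewrite (proj1 (proj2 Hs)) in E.
  replace (f z) with (slope f 0 z * z)%C.
  - field. auto.
  - transitivity (slope f 0 z * (z - 0))%C; [ring|]. rewrite E. ring.
Qed.

Lemma spiral_ratio_0 : spiral_ratio f 0 = 1.
Proof.
  unfold spiral_ratio. rewrite slope_diag. field.
  apply univalent_derive_neq_0; auto. apply unit_disk_0.
Qed.

Lemma holomorphic_spiral_ratio : holomorphic_on unit_disk (spiral_ratio f).
Proof.
  intros z Hz.
  destruct (holomorphic_C_derive f Hf z Hz) as [l Hl].
  destruct (holomorphic_slope f 0 unit_disk_0 Hf z Hz) as [m Hm].
  eexists. apply is_Cderive_div; [exact Hl | exact Hm |].
  apply univalent_slope_neq_0; auto. apply unit_disk_0.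
Qed.

(** The function P of the overview: adding i sin lambda and dividing by cos lambda turns the value
    e^{-i lambda} at 0 into 1. *)
Definition caratheodory_part (z : C) : C :=
  ((Cexp (Ci * (- lambda)%R) * spiral_ratio f z + Ci * sin lambda) / cos lambda)%C.

Lemma holomorphic_caratheodory_part : holomorphic_on unit_disk caratheodory_part.
Proof.
  intros z Hz. destruct (holomorphic_spiral_ratio z Hz) as [l Hl].
  eexists. apply is_Cderive_mult; [|apply is_Cderive_const].
  apply is_Cderive_plus; [|apply is_Cderive_const].
  apply is_Cderive_mult; [apply is_Cderive_const | exact Hl].
Qed.

Lemma spiral_ratio_caratheodory (z : C) :
  (Cexp (Ci * (- lambda)%R) * spiral_ratio f z)%C = (cos lambda * caratheodory_part z - Ci * sin lambda)%C.
Proof.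
  unfold caratheodory_part. field. intros E%RtoC_inj. pose proof cos_lambda_pos. lra.
Qed.

Lemma caratheodory_part_0 : caratheodory_part 0 = 1.
Proof.
  unfold caratheodory_part. rewrite spiral_ratio_0, Cexp_Ci, cos_neg, sin_neg.
  assert (E : RtoC (cos lambda) <> 0) by (intros E%RtoC_inj; pose proof cos_lambda_pos; lra).
  replace ((cos lambda, (- sin lambda)%R) * 1 + Ci * sin lambda)%C with (RtoC (cos lambda))
    by (apply injective_projections; cbn; ring).
  field. auto.
Qed.

Lemma Re_caratheodory_part (z : C) :
  Re (caratheodory_part z) = Re (Cexp (Ci * (- lambda)%R) * spiral_ratio f z) / cos lambda.
Proof.
  pose proof cos_lambda_pos. rewrite spiral_ratio_caratheodory.
  set (P := caratheodory_part z).
  replace (Re (cos lambda * P - Ci * sin lambda)) with (cos lambda * Re P)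
    by (destruct P; cbn; ring).
  field. lra.
Qed.

(** For z <> 0, q = e^{-i lambda} h and the quantity v of [spirallike_infinitesimal] have the
    positive product |z|^2. Hence Re q |v|^2 = |z|^2 Re v, and the two real parts have the same
    sign. *)
Lemma Re_caratheodory_part_nonneg (z : C) : unit_disk z -> 0 <= Re (caratheodory_part z).
Proof.
  intros Hz. pose proof cos_lambda_pos as Hcos.
  destruct (Ceq_dec z 0) as [->|Hz0].
  { rewrite caratheodory_part_0. cbn. lra. }
  rewrite Re_caratheodory_part. apply Rdiv_le_0_compat; auto.
  pose proof (spirallike_infinitesimal lambda f z Hs Hz) as H.
  set (v := (Cconj z * (Cexp (Ci * lambda) * f z / C_derive f z))%C) in *.
  assert (Hd : C_derive f z <> 0) by now apply univalent_derive_neq_0.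
  assert (Hcz : Cconj z <> 0) by (apply Cmod_gt_0; rewrite Cmod_conj; now apply Cmod_gt_0).
  assert (E : (Cexp (Ci * (- lambda)%R) * spiral_ratio f z * v)%C = RtoC (Cmod z ^ 2)).
  { rewrite Cmod2_conj. unfold v.
    transitivity ((Cexp (Ci * (- lambda)%R) * Cexp (Ci * lambda)) * (Cconj z * (f z * spiral_ratio f z) / C_derive f z))%C;
      [field; auto|].
    rewrite <- spiral_ratio_mult by auto.
    rewrite <- Cexp_plus. replace (Ci * (- lambda)%R + Ci * lambda)%C with (RtoC 0)
      by (rewrite RtoC_opp; ring).
    rewrite Cexp_0. field. auto. }
  set (q := (Cexp (Ci * (- lambda)%R) * spiral_ratio f z)%C) in *.
  assert (Hm : 0 < Cmod z ^ 2) by (apply pow_lt; now apply Cmod_gt_0).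
  assert (E1 : Re q * Re v - Im q * Im v = Cmod z ^ 2) by (rewrite <- re_mult, E; reflexivity).
  assert (E2 : Re q * Im v + Im q * Re v = 0) by (rewrite <- im_mult, E; reflexivity).
  assert (E3 : Re q * (Re v * Re v + Im v * Im v) = Cmod z ^ 2 * Re v).
  { transitivity ((Re q * Re v - Im q * Im v) * Re v + (Re q * Im v + Im q * Re v) * Im v); [ring|].
    rewrite E1, E2. ring. }
  apply Rnot_lt_le. intros Hq.
  assert (0 <= Cmod z ^ 2 * Re v) by (apply Rmult_le_pos; lra).
  assert (Hsum : Re v * Re v + Im v * Im v = 0).
  { pose proof (Rle_0_sqr (Re v)). pose proof (Rle_0_sqr (Im v)). unfold Rsqr in *. nra. }
  assert (Re v = 0) by nra. assert (Im v = 0) by nra. nra.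
Qed.

Lemma Cmod_spiral_ratio_le (z : C) : unit_disk z ->
  Cmod (spiral_ratio f z) <=
  cos lambda * Re (caratheodory_part z) + Rabs (sin lambda) + cos lambda * Rabs (Im (caratheodory_part z)).
Proof.
  intros Hz. pose proof cos_lambda_pos as Hcos.
  pose proof (Re_caratheodory_part_nonneg z Hz) as Hre.
  replace (Cmod (spiral_ratio f z)) with (Cmod (Cexp (Ci * (- lambda)%R) * spiral_ratio f z))
    by (rewrite Cmod_mult, Cmod_Cexp_Ci; ring).
  rewrite spiral_ratio_caratheodory.
  set (P := caratheodory_part z) in *.
  replace (cos lambda * P - Ci * sin lambda)%C
    with (RtoC (cos lambda * Re P) + Ci * RtoC (- sin lambda) + Ci * RtoC (cos lambda * Im P))%C
    by (destruct P; apply injective_projections; cbn; ring).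
  eapply Rle_trans; [apply Cmod_triangle|].
  eapply Rle_trans; [apply Rplus_le_compat_r, Cmod_triangle|].
  rewrite !Cmod_mult, Cmod_Ci, !Cmod_R, Rabs_Ropp, !Rabs_mult, (Rabs_pos_eq (cos lambda)), (Rabs_pos_eq (Re P)) by lra.
  lra.
Qed.

End spirallike.

(** * Integral means of conjugate functions *)

Lemma ex_RInt_continuous_R (f : R -> R) (a b : R) : (forall x, continuous f x) -> ex_RInt f a b.
Proof. intros H. apply (ex_RInt_continuous (V := R_CompleteNormedModule)). auto. Qed.

Lemma RInt_param_continuous (f : R -> R -> R) (a b x0 : R) :
  a <= b -> (forall p, continuous (fun p : R * R => f (fst p) (snd p)) p) ->
  continuous (fun x => RInt (f x) a b) x0.
Proof.
  intros Hab Hf.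
  assert (Hx : forall x, path_continuous (fun t => RtoC (f x t)) a b).
  { intros x. apply (@jointly_continuous_path R_UniformSpace (fun x t => RtoC (f x t))).
    intros t _. apply continuous_RtoC, Hf. }
  apply continuous_ext with (fun x => Re (CInt (fun t => RtoC (f x t)) a b)).
  - intros x. rewrite Re_CInt; auto.
  - apply continuous_Re. apply (@CInt_param_continuous R_UniformSpace); auto.
    + intros t _. apply continuous_RtoC, Hf.
    + apply filter_forall. exact Hx.
Qed.

(** Fubini for continuous integrands: with b replaced by a variable x, both sides have the
    derivative [RInt (f x) c d] and vanish at x = a. *)
Lemma RInt_exchange (f : R -> R -> R) (a b c d : R) :
  a < b -> c <= d -> (forall p, continuous (fun p : R * R => f (fst p) (snd p)) p) ->
  RInt (fun x => RInt (f x) c d) a b = RInt (fun y => RInt (fun x => f x y) a b) c d.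
Proof.
  intros Hab Hcd Hf.
  assert (Hf' : forall p, continuous (fun p : R * R => f (snd p) (fst p)) p).
  { intros p. apply (continuous_comp (fun p : R * R => (snd p, fst p)) (fun p => f (fst p) (snd p))); auto.
    apply (continuous_comp_2 snd fst (fun x y => (x, y))).
    - apply continuous_snd.
    - apply continuous_fst.
    - apply (continuous_ext (fun xy => xy)); [now intros [? ?] | apply continuous_id]. }
  assert (Hfx : forall x y, continuous (f x) y).
  { intros x y. apply (continuous_comp_2 (fun _ => x) (fun y => y) f); auto.
    - apply continuous_const.
    - apply continuous_id. }
  assert (Hfy : forall x y, continuous (fun x => f x y) x).
  { intros x y. apply (continuous_comp_2 (fun x => x) (fun _ => y) f); auto.
    - apply continuous_id.
    - apply continuous_const. }
  assert (HF : forall x y, is_derive (fun x => RInt (fun s => f s y) a x) x (f x y)).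
  { intros x y. apply (is_derive_RInt (fun s => f s y) _ a); auto.
    apply filter_forall. intros x'. apply (RInt_correct (V := R_CompleteNormedModule)), ex_RInt_continuous_R. auto. }
  assert (HFc : forall x y, continuous (fun y => RInt (fun s => f s y) a x) y).
  { intros x y. destruct (Rle_lt_dec a x) as [H|H].
    - apply (RInt_param_continuous (fun y s => f s y)); auto.
    - apply continuous_ext with (fun y => opp (RInt (fun s => f s y) x a)).
      + intros y'. apply opp_RInt_swap, ex_RInt_continuous_R. auto.
      + apply (continuous_opp (V := R_NormedModule)).
        apply (RInt_param_continuous (fun y s => f s y)); [lra | auto]. }
  set (Phi := fun x => RInt (fun y => RInt (fun s => f s y) a x) c d
                       - RInt (fun s => RInt (f s) c d) a x : R).
  assert (HPhi : forall x, is_derive Phi x 0).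
  { intros x. replace 0 with (RInt (f x) c d - RInt (f x) c d) by ring.
    apply (is_derive_minus (V := R_NormedModule)
      (fun x => RInt (fun y => RInt (fun s => f s y) a x) c d)
      (fun x => RInt (fun s => RInt (f s) c d) a x)).
    - assert (ED : forall u v, Derive (fun z => RInt (fun s => f s v) a z) u = f u v)
        by (intros u v; apply is_derive_unique, HF).
      rewrite <- (RInt_ext (fun y => Derive (fun z => RInt (fun s => f s y) a z) x) (f x) c d)
        by (intros; apply ED).
      apply (is_derive_RInt_param (fun x y => RInt (fun s => f s y) a x)).
      + apply filter_forall. intros u v _. eexists. apply HF.
      + intros t _. apply continuity_2d_pt_ext with f; [intros; now rewrite ED|].
        apply continuity_2d_pt_filterlim. apply (Hf (x, t)).
      + apply filter_forall. intros u. apply ex_RInt_continuous_R. auto.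
    - apply (is_derive_RInt (fun s => RInt (f s) c d) _ a).
      + apply filter_forall. intros x'. apply (RInt_correct (V := R_CompleteNormedModule)), ex_RInt_continuous_R.
        intros y. now apply RInt_param_continuous.
      + now apply RInt_param_continuous. }
  assert (E : Phi a = Phi b) by now apply (eq_is_derive (V := R_NormedModule) Phi a b).
  assert (Z1 : RInt (fun y => RInt (fun s => f s y) a a) c d = 0).
  { rewrite (RInt_ext _ (fun _ => 0)) by (intros; apply (RInt_point (V := R_CompleteNormedModule))).
    rewrite RInt_const. apply Rmult_0_r. }
  assert (Z2 : RInt (fun s => RInt (f s) c d) a a = 0) by apply (RInt_point (V := R_CompleteNormedModule)).
  unfold Phi in E. rewrite Z1, Z2 in E. lra.
Qed.

(** The piece over [-s, 0] brought in by the shift is moved by one period onto [T - s, T]. *)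
Lemma RInt_periodic_shift (k : R -> R) (T s : R) :
  (forall x, continuous k x) -> (forall x, k (x + T) = k x) ->
  RInt (fun x => k (x - s)) 0 T = RInt k 0 T.
Proof.
  intros Hk HT.
  assert (Hex : forall a b, ex_RInt k a b) by (intros; now apply ex_RInt_continuous_R).
  assert (Hlin : forall v a b, RInt (fun x => k (x + v)) a b = RInt k (a + v) (b + v)).
  { intros v a b. pose proof (RInt_comp_lin k 1 v a b (Hex _ _)) as H.
    rewrite !Rmult_1_l in H. rewrite <- H. apply RInt_ext.
    intros x _. unfold scal. cbn. unfold mult. cbn. now rewrite !Rmult_1_l. }
  change (RInt (fun x => k (x + - s)) 0 T = RInt k 0 T). rewrite Hlin.
  rewrite <- (RInt_Chasles k (0 + - s) 0 (T + - s)) by apply Hex.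
  rewrite <- (RInt_Chasles k 0 (T + - s) T) by apply Hex.
  rewrite (RInt_ext k (fun x => k (x + T)) (0 + - s) 0) by (intros; now rewrite HT).
  rewrite Hlin. replace (0 + - s + T) with (T + - s) by ring. replace (0 + T) with T by ring.
  apply Rplus_comm.
Qed.

(* Im (zeta / (zeta - z)) for zeta = rho e^{i phi}, z = r e^{i theta}, psi = theta - phi. *)
Definition conjugate_kernel (rho r psi : R) : R :=
  rho * r * sin psi / (rho * rho - 2 * rho * r * cos psi + r * r).

Section kernel.
Variables (rho r : R).
Hypothesis Hr : 0 < r < rho.

Lemma conjugate_kernel_den_pos (psi : R) : 0 < rho * rho - 2 * rho * r * cos psi + r * r.
Proof.
  pose proof (COS_bound psi) as H.
  assert (0 < (rho - r) * (rho - r)) by nra.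
  assert (0 <= 2 * (rho * r) * (1 - cos psi)) by (apply Rmult_le_pos; nra). lra.
Qed.

(** The primitive is log |zeta - z|, as the denominator of the kernel is |zeta - z|^2. *)
Lemma is_derive_log_den (psi : R) :
  is_derive (fun t => / 2 * ln (rho * rho - 2 * rho * r * cos t + r * r)) psi
    (conjugate_kernel rho r psi).
Proof.
  pose proof (conjugate_kernel_den_pos psi) as H. unfold conjugate_kernel.
  auto_derive.
  - lra.
  - field. lra.
Qed.

Lemma conjugate_kernel_continuous (psi : R) : continuous (conjugate_kernel rho r) psi.
Proof.
  pose proof (conjugate_kernel_den_pos psi) as H.
  apply (ex_derive_continuous (V := R_NormedModule)). unfold conjugate_kernel. auto_derive. lra.
Qed.

Lemma Rabs_conjugate_kernel_continuous (psi : R) :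
  continuous (fun t => Rabs (conjugate_kernel rho r t)) psi.
Proof.
  apply (continuous_comp (conjugate_kernel rho r) Rabs).
  - apply conjugate_kernel_continuous.
  - apply continuous_Rabs.
Qed.

Lemma RInt_conjugate_kernel (a b : R) : a <= b ->
  RInt (conjugate_kernel rho r) a b =
  / 2 * ln (rho * rho - 2 * rho * r * cos b + r * r) - / 2 * ln (rho * rho - 2 * rho * r * cos a + r * r).
Proof.
  intros Hab. apply is_RInt_unique.
  apply (is_RInt_derive (V := R_CompleteNormedModule)
    (fun t => / 2 * ln (rho * rho - 2 * rho * r * cos t + r * r))).
  - intros x _. apply is_derive_log_den.
  - intros x _. apply conjugate_kernel_continuous.
Qed.

Lemma conjugate_kernel_sign (psi : R) :
  (0 <= sin psi -> Rabs (conjugate_kernel rho r psi) = conjugate_kernel rho r psi) /\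
  (sin psi <= 0 -> Rabs (conjugate_kernel rho r psi) = - conjugate_kernel rho r psi).
Proof.
  pose proof (conjugate_kernel_den_pos psi) as H. unfold conjugate_kernel.
  assert (Hi : 0 < / (rho * rho - 2 * rho * r * cos psi + r * r)) by now apply Rinv_0_lt_compat.
  assert (0 < rho * r) by nra.
  split; intros Hs; [apply Rabs_pos_eq | apply Rabs_left1]; unfold Rdiv;
    set (i := / _) in *.
  - apply Rmult_le_pos; nra.
  - assert (0 <= rho * r * (- sin psi) * i) by (apply Rmult_le_pos; nra). lra.
Qed.

(** The kernel has the sign of sin, so each half period contributes the variation of log |zeta - z|
    between its extremes log (rho - r) and log (rho + r). *)
Lemma RInt_Rabs_conjugate_kernel :
  RInt (fun psi => Rabs (conjugate_kernel rho r psi)) 0 (2 * PI) = 2 * ln ((rho + r) / (rho - r)).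
Proof.
  pose proof PI_RGT_0 as Hpi.
  assert (Hex : forall a b, ex_RInt (fun psi => Rabs (conjugate_kernel rho r psi)) a b).
  { intros. apply ex_RInt_continuous_R, Rabs_conjugate_kernel_continuous. }
  rewrite <- (RInt_Chasles _ 0 PI (2 * PI)) by apply Hex.
  rewrite (RInt_ext _ (conjugate_kernel rho r) 0 PI).
  2: { rewrite Rmin_left, Rmax_right by lra. intros x Hx.
    apply conjugate_kernel_sign, sin_ge_0; lra. }
  rewrite (RInt_ext _ (fun x => opp (conjugate_kernel rho r x : R_CompleteNormedModule)) PI (2 * PI)).
  2: { rewrite Rmin_left, Rmax_right by lra. intros x Hx.
    apply conjugate_kernel_sign, sin_le_0; lra. }
  rewrite (RInt_opp (V := R_CompleteNormedModule) (conjugate_kernel rho r))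
    by apply ex_RInt_continuous_R, conjugate_kernel_continuous.
  rewrite !RInt_conjugate_kernel by lra.
  rewrite cos_0, cos_PI, cos_2PI.
  replace (rho * rho - 2 * rho * r * -1 + r * r) with ((rho + r) * (rho + r)) by ring.
  replace (rho * rho - 2 * rho * r * 1 + r * r) with ((rho - r) * (rho - r)) by ring.
  rewrite !ln_mult, ln_div by lra. unfold plus, opp. cbn. field.
Qed.

Lemma Im_cauchy_kernel (theta phi : R) :
  Im (circle 0 rho phi / (circle 0 rho phi - circle 0 r theta)) = conjugate_kernel rho r (theta - phi).
Proof.
  pose proof (conjugate_kernel_den_pos (theta - phi)) as H. unfold conjugate_kernel.
  unfold circle. rewrite !Cexp_Ci.
  rewrite cos_minus in *. rewrite sin_minus.
  pose proof (sin2_cos2 theta) as H1. pose proof (sin2_cos2 phi) as H2. unfold Rsqr in H1, H2.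
  cbn.
  set (ct := cos theta) in *. set (st := sin theta) in *.
  set (cp := cos phi) in *. set (sp := sin phi) in *.
  match goal with |- ?L = _ => match L with context [?X / ?D] =>
    replace D with (rho * rho - 2 * rho * r * (ct * cp + st * sp) + r * r) end end.
  - field. lra.
  - transitivity (rho * rho * (sp * sp + cp * cp) - 2 * rho * r * (ct * cp + st * sp)
      + r * r * (st * st + ct * ct)); [rewrite H1, H2|]; ring.
Qed.

End kernel.

(** * Schwarz's integral formula and the mean of |Im P| *)

Section conjugate_function.
Variable P : C -> C.
Hypotheses (HP : holomorphic_on unit_disk P) (HP0 : P 0 = 1)
           (HPre : forall z, unit_disk z -> 0 <= Re (P z)).

Lemma on_circle_continuous (rho phi : R) : 0 < rho < 1 -> continuous (fun t => P (circle 0 rho t)) phi.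
Proof.
  intros H. apply (continuous_comp (circle 0 rho) P); [apply circle_continuous|].
  apply holomorphic_continuous; auto. rewrite Cmod_circle_0; lra.
Qed.

Lemma RInt_Re_circle (rho : R) : 0 < rho < 1 ->
  RInt (fun phi => Re (P (circle 0 rho phi))) 0 (2 * PI) = 2 * PI.
Proof.
  intros Hrho. pose proof two_PI_pos as Hpi.
  rewrite <- Re_CInt; [|lra|intros t _; now apply on_circle_continuous].
  rewrite (circle_mean_value P 0 rho 1).
  - rewrite HP0. cbn. ring.
  - lra.
  - apply holomorphic_continuous; auto. rewrite Cmod_0. lra.
  - intros z Hz. apply HP. unfold unit_disk. replace z with (z - 0)%C by ring. lra.
Qed.

(** The sum of Cauchy's formulas for P and for its conjugate has 2 Re P under the integral and 2 pi
    P(z) + 2 pi conj P(0) on the right. As P(0) = 1 is real, taking imaginary parts leaves only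
    P(z). *)
Lemma Im_schwarz_formula (rho r theta : R) : 0 < r < rho -> rho < 1 ->
  RInt (fun phi => Re (P (circle 0 rho phi)) * conjugate_kernel rho r (theta - phi)) 0 (2 * PI) =
  PI * Im (P (circle 0 r theta)).
Proof.
  intros Hr Hrho. pose proof two_PI_pos as Hpi.
  set (z := circle 0 r theta).
  assert (Hz : Cmod z < rho < 1) by (unfold z; rewrite Cmod_circle_0; lra).
  pose proof (cauchy_formula z rho Hz P HP) as E1.
  pose proof (cauchy_formula_conj z rho Hz P HP) as E2.
  assert (Hk : forall t, continuous (fun phi => circle 0 rho phi / (circle 0 rho phi - z))%C t)
    by apply (cauchy_kernel_continuous z rho Hz).
  assert (Hc1 : path_continuous (fun phi => P (circle 0 rho phi) *
    (circle 0 rho phi / (circle 0 rho phi - z)))%C 0 (2 * PI)).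
  { intros t _. apply continuous_Cmult; auto. apply on_circle_continuous. lra. }
  assert (Hc2 : path_continuous (fun phi => Cconj (P (circle 0 rho phi)) *
    (circle 0 rho phi / (circle 0 rho phi - z)))%C 0 (2 * PI)).
  { intros t _. apply continuous_Cmult; auto. apply continuous_Cconj, on_circle_continuous. lra. }
  assert (E : CInt (fun phi => P (circle 0 rho phi) * (circle 0 rho phi / (circle 0 rho phi - z))
     + Cconj (P (circle 0 rho phi)) * (circle 0 rho phi / (circle 0 rho phi - z)))%C 0 (2 * PI)
     = (2 * PI * P z + 2 * PI * Cconj (P 0))%C).
  { rewrite CInt_plus; auto; [|lra]. now rewrite <- E1, <- E2. }
  apply (f_equal Im) in E. rewrite Im_CInt in E; [|lra|].
  2: { intros t Ht. apply continuous_Cplus; auto. }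
  rewrite (RInt_ext _ (fun phi => scal 2 (Re (P (circle 0 rho phi)) * conjugate_kernel rho r (theta - phi)))) in E.
  - rewrite (RInt_scal (V := R_CompleteNormedModule)
      (fun phi => Re (P (circle 0 rho phi)) * conjugate_kernel rho r (theta - phi))) in E.
    + match type of E with scal _ ?I = _ => change (2 * I = Im (2 * PI * P z + 2 * PI * Cconj (P 0))) in E end.
      rewrite HP0 in E.
      replace (Im (2 * PI * P z + 2 * PI * Cconj 1)) with (2 * (PI * Im (P z))) in E
        by (destruct (P z); cbn; ring).
      lra.
    + apply ex_RInt_continuous_R. intros t. apply continuous_Rmult.
      * apply continuous_Re, on_circle_continuous. lra.
      * apply continuous_ext with (fun phi => Im (circle 0 rho phi / (circle 0 rho phi - z))%C).
        -- intros phi. now apply Im_cauchy_kernel.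
        -- now apply continuous_Im.
  - intros phi _. rewrite <- Cmult_plus_distr_r, im_mult.
    unfold z. rewrite Im_cauchy_kernel by auto.
    rewrite re_plus, im_plus, re_conj, im_conj.
    unfold scal. cbn. unfold mult. cbn. unfold Re. ring.
Qed.

(** Since Re P >= 0, absolute values fall on the kernel alone. After exchanging the integrals, the
    inner one is by periodicity the same L^1 norm for every phi. *)
Lemma RInt_Rabs_Im_le (rho r : R) : 0 < r < rho -> rho < 1 ->
  RInt (fun theta => Rabs (Im (P (circle 0 r theta)))) 0 (2 * PI) <= 4 * ln ((rho + r) / (rho - r)).
Proof.
  intros Hr Hrho. pose proof PI_RGT_0 as Hpi.
  set (u := fun phi => Re (P (circle 0 rho phi))).
  set (k := fun psi => Rabs (conjugate_kernel rho r psi)).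
  assert (Hu : forall t, continuous u t).
  { intros t. apply continuous_Re, on_circle_continuous. lra. }
  assert (Hu0 : forall t, 0 <= u t).
  { intros t. apply HPre. unfold unit_disk. rewrite Cmod_circle_0; lra. }
  assert (Hk : forall t, continuous k t) by now apply Rabs_conjugate_kernel_continuous.
  assert (Hjoint : forall p : R * R, continuous (fun p => u (snd p) * k (fst p - snd p)) p).
  { intros p. apply continuous_Rmult.
    - apply (continuous_comp snd u); auto. apply continuous_snd.
    - apply (continuous_comp (fun p : R * R => fst p - snd p) k); auto.
      apply (continuous_minus (V := R_NormedModule)); [apply continuous_fst | apply continuous_snd]. }
  assert (Hint : forall theta, continuous (fun t => RInt (fun phi => u phi * k (t - phi)) 0 (2 * PI)) theta).
  { intros theta. apply (RInt_param_continuous (fun t phi => u phi * k (t - phi))); [lra | auto]. }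
  assert (Hsh : forall theta t, continuous (fun phi => conjugate_kernel rho r (theta - phi)) t).
  { intros theta t. apply (continuous_comp (fun phi => theta - phi) (conjugate_kernel rho r)).
    - apply (continuous_minus (V := R_NormedModule)); [apply continuous_const | apply continuous_id].
    - now apply conjugate_kernel_continuous. }
  assert (Hpt : forall theta, Rabs (Im (P (circle 0 r theta))) <=
    / PI * RInt (fun phi => u phi * k (theta - phi)) 0 (2 * PI)).
  { intros theta. apply Rmult_le_reg_l with PI; auto.
    rewrite <- Rmult_assoc, Rinv_r, Rmult_1_l by lra.
    rewrite <- (Rabs_pos_eq PI) at 1 by lra. rewrite <- Rabs_mult.
    rewrite <- (Im_schwarz_formula rho r theta Hr Hrho).
    assert (Hex : ex_RInt (fun phi => u phi * conjugate_kernel rho r (theta - phi)) 0 (2 * PI)).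
    { apply ex_RInt_continuous_R. intros t. now apply continuous_Rmult. }
    eapply Rle_trans; [apply abs_RInt_le; [lra | exact Hex]|].
    right. apply RInt_ext. intros t _. unfold k. rewrite Rabs_mult, (Rabs_pos_eq (Re _)); auto.
    apply Hu0. }
  eapply Rle_trans.
  - apply (RInt_le _ (fun theta => / PI * RInt (fun phi => u phi * k (theta - phi)) 0 (2 * PI))); [lra| | |].
    + apply ex_RInt_continuous_R. intros t.
      apply (continuous_comp (fun theta => Im (P (circle 0 r theta))) Rabs); [|apply continuous_Rabs].
      apply continuous_Im, on_circle_continuous. lra.
    + apply ex_RInt_continuous_R. intros t. apply continuous_Rmult; [apply continuous_const | apply Hint].
    + intros t _. apply Hpt.
  - right.
    transitivity (/ PI * RInt (fun theta => RInt (fun phi => u phi * k (theta - phi)) 0 (2 * PI)) 0 (2 * PI)).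
    { apply (RInt_scal (V := R_CompleteNormedModule)), ex_RInt_continuous_R. auto. }
    rewrite (RInt_exchange (fun theta phi => u phi * k (theta - phi))) by (auto; lra).
    rewrite (RInt_ext _ (fun phi => 2 * ln ((rho + r) / (rho - r)) * u phi)).
    + transitivity (/ PI * (2 * ln ((rho + r) / (rho - r)) * RInt u 0 (2 * PI))).
      { f_equal. apply (RInt_scal (V := R_CompleteNormedModule)), ex_RInt_continuous_R. auto. }
      unfold u. rewrite RInt_Re_circle by lra. field. lra.
    + intros phi _.
      transitivity (u phi * RInt (fun theta => k (theta - phi)) 0 (2 * PI)).
      * apply (RInt_scal (V := R_CompleteNormedModule)), ex_RInt_continuous_R.
        intros t. apply (continuous_comp (fun theta => theta - phi) k); auto.
        apply (continuous_minus (V := R_NormedModule)); [apply continuous_id | apply continuous_const].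
      * rewrite RInt_periodic_shift; auto.
        -- unfold k. rewrite RInt_Rabs_conjugate_kernel by auto. apply Rmult_comm.
        -- intros x. unfold k, conjugate_kernel.
           now rewrite sin_plus, cos_plus, sin_2PI, cos_2PI, !Rmult_0_r, !Rmult_1_r, Rplus_0_r, Rminus_0_r.
Qed.

End conjugate_function.

(** * The length estimate *)

(** The origin of sqrt 2 in the theorem; squared, it follows from (cos lambda - |sin lambda|)^2 >=
    0. *)
Lemma cos_plus_Rabs_sin_le (lambda : R) : cos lambda + Rabs (sin lambda) <= sqrt 2.
Proof.
  apply Rsqr_incr_0_var; [|apply sqrt_pos].
  rewrite Rsqr_sqrt by lra.
  pose proof (sin2_cos2 lambda) as H. rewrite (Rsqr_abs (sin lambda)) in H.
  pose proof (Rle_0_sqr (cos lambda - Rabs (sin lambda))) as H2. unfold Rsqr in *. nra.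
Qed.

(** On |z| = r the identity z f' = f h gives r |f'| <= M(r, f) |h|, so only the integral of |h|
    remains to be bounded. *)
Lemma length_bound (lambda : R) (f : C -> C) (rho r : R) :
  - (PI / 2) < lambda < PI / 2 -> spirallike lambda f -> 0 < r < rho -> rho < 1 ->
  L r f <= M r f * (2 * sqrt 2 * PI + 4 * cos lambda * ln ((rho + r) / (rho - r))).
Proof.
  intros Hlambda Hs Hr Hrho. pose proof PI_RGT_0 as Hpi.
  pose proof (proj1 Hs) as Hf.
  pose proof (cos_lambda_pos lambda Hlambda) as Hcos.
  set (P := caratheodory_part lambda f).
  pose proof (holomorphic_caratheodory_part lambda f Hs : holomorphic_on unit_disk P) as HP.
  pose proof (caratheodory_part_0 lambda f Hlambda Hs : P 0 = 1) as HP0.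
  assert (HPre : forall z, unit_disk z -> 0 <= Re (P z))
    by (intros z Hz; now apply Re_caratheodory_part_nonneg).
  assert (Hz : forall t, unit_disk (circle 0 r t))
    by (intros t; unfold unit_disk; rewrite Cmod_circle_0; lra).
  destruct (M_is_max r f ltac:(lra) Hf) as [[z0 [Hz0 Ez0]] HM].
  assert (HM0 : 0 <= M r f) by (rewrite <- Ez0; apply Cmod_ge_0).
  assert (HPc : forall t, continuous (fun t => P (circle 0 r t)) t)
    by (intros t; apply on_circle_continuous; auto; lra).
  assert (HRe : forall t, continuous (fun t => Re (P (circle 0 r t))) t)
    by (intros t; now apply continuous_Re).
  assert (HIm : forall t, continuous (fun t => Rabs (Im (P (circle 0 r t)))) t).
  { intros t. apply (continuous_comp (fun t => Im (P (circle 0 r t))) Rabs);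
      [now apply continuous_Im | apply continuous_Rabs]. }
  set (g := fun t => cos lambda * Re (P (circle 0 r t)) + Rabs (sin lambda)
                     + cos lambda * Rabs (Im (P (circle 0 r t)))).
  assert (Hg : forall t, continuous g t).
  { intros t. apply (continuous_plus (V := R_NormedModule)); [apply (continuous_plus (V := R_NormedModule))|].
    - apply continuous_Rmult; [apply continuous_const | auto].
    - apply continuous_const.
    - apply continuous_Rmult; [apply continuous_const | auto]. }
  assert (HL : L r f <= RInt (fun t => M r f * g t) 0 (2 * PI)).
  { apply RInt_le; [lra| | |].
    - apply ex_RInt_continuous_R. intros t. apply continuous_Rmult; [apply continuous_const|].
      apply continuous_Cmod.
      apply (continuous_ext (fun t => C_derive f (circle 0 r t))).
      + intros s. unfold circle. now rewrite Cplus_0_l.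
      + apply on_circle_continuous; [now apply holomorphic_C_derive | lra].
    - apply ex_RInt_continuous_R. intros t. apply continuous_Rmult; [apply continuous_const | auto].
    - intros t _. replace (r * Cexp (Ci * t))%C with (circle 0 r t) by (unfold circle; ring).
      rewrite <- (Cmod_circle_0 r t) at 1 by lra.
      rewrite <- Cmod_mult, (spiral_ratio_mult lambda f Hs) by auto.
      rewrite Cmod_mult. apply Rmult_le_compat; try apply Cmod_ge_0.
      + apply HM, Cmod_circle_0. lra.
      + now apply Cmod_spiral_ratio_le. }
  eapply Rle_trans; [exact HL|].
  replace (RInt (fun t => M r f * g t) 0 (2 * PI)) with (M r f * RInt g 0 (2 * PI))
    by (symmetry; apply (RInt_scal (V := R_CompleteNormedModule)), ex_RInt_continuous_R; auto).
  apply Rmult_le_compat_l; auto.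
  assert (E : RInt g 0 (2 * PI) = cos lambda * (2 * PI) + 2 * PI * Rabs (sin lambda)
    + cos lambda * RInt (fun t => Rabs (Im (P (circle 0 r t)))) 0 (2 * PI)).
  { apply is_RInt_unique.
    apply (is_RInt_plus (V := R_NormedModule)); [apply (is_RInt_plus (V := R_NormedModule))|].
    - pose proof (RInt_correct (V := R_CompleteNormedModule) _ _ _
        (ex_RInt_continuous_R _ 0 (2 * PI) HRe)) as H.
      change (is_RInt (fun t => Re (P (circle 0 r t))) 0 (2 * PI)
        (RInt (fun t => Re (P (circle 0 r t))) 0 (2 * PI) : R)) in H.
      rewrite (RInt_Re_circle P HP HP0 r) in H by lra.
      exact (is_RInt_scal (V := R_NormedModule) _ _ _ (cos lambda) _ H).
    - replace (2 * PI * Rabs (sin lambda)) with ((2 * PI - 0) * Rabs (sin lambda)) by ring.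
      apply (is_RInt_const (V := R_NormedModule)).
    - apply (is_RInt_scal (V := R_NormedModule)),
        (RInt_correct (V := R_CompleteNormedModule)), ex_RInt_continuous_R. auto. }
  rewrite E.
  pose proof (RInt_Rabs_Im_le P HP HP0 HPre rho r Hr Hrho) as HI.
  pose proof (cos_plus_Rabs_sin_le lambda) as Hsq.
  apply Rmult_le_compat_l with (r := cos lambda) in HI; [|lra].
  apply Rmult_le_compat_l with (r := 2 * PI) in Hsq; lra.
Qed.

Theorem theorem1p1 :
  forall (lambda : R) (f : C -> C),
    - (PI / 2) < lambda < PI / 2 ->
    spirallike lambda f ->
    forall r : R, 0 < r < 1 ->
      L r f <= M r f * (2 * sqrt 2 * PI + 4 * cos lambda * ln ((1 + r) / (1 - r))).
Proof.
  intros lambda f Hlambda Hs r Hr.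
  set (B := fun rho => M r f * (2 * sqrt 2 * PI + 4 * cos lambda * ln ((rho + r) / (rho - r)))).
  change (L r f <= B 1).
  assert (Hc : continuous B 1).
  { apply (ex_derive_continuous (V := R_NormedModule)). unfold B. auto_derive.
    repeat split; try lra. apply Rdiv_lt_0_compat; lra. }
  (* By continuity of [B] at 1, a failure at rho = 1 would persist at some rho = 1 - e with r < rho
     < 1, against [length_bound]. *)
  apply Rnot_lt_le. intros Hlt.
  destruct (Hc (fun y => y < L r f) (open_lt _ _ Hlt)) as [d Hd].
  pose proof (cond_pos d) as Hdp.
  set (e := Rmin (d / 2) ((1 - r) / 2)).
  assert (He : 0 < e) by (apply Rmin_glb_lt; lra).
  assert (He1 : e <= d / 2) by apply Rmin_l.
  assert (He2 : e <= (1 - r) / 2) by apply Rmin_r.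
  assert (Hball : ball 1 d (1 - e)).
  { change (Rabs (1 - e - 1) < d). rewrite Rabs_left; lra. }
  apply (Rlt_not_le _ _ (Hd _ Hball)).
  apply length_bound; auto; lra.
Qed.
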